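(* Let $n\in\mathbb{N}$. (i) The canonical *-homomorphism from $\mathcal{A}(S^{2n+1}_0)$ to its C*-enveloping algebra $C(S^{2n+1}_0)$ is injective. (ii) A $U(1)$-equivariant isomorphism $\varphi:L_{\mathbb{C}}(\Sigma_n)\to\mathcal{A}(S^{2n+1}_0)$ is given by $$\varphi(P_{v_i})=z_iz_i^*,\qquad \varphi(S_{e_{i,j}})=z_iz_jz_j^*,$$ for all $0\leq i\leq j\leq n$. Its inverse is given on generators by $\varphi^{-1}(z_i)=\sum_{j=i}^nS_{e_{i,j}}$ for all $0\leq i\leq n$. (iii) The map $\varphi$ extends to an isomorphism of C*-algebras $\widetilde{\varphi}:C^*(\Sigma_n)\to C(S^{2n+1}_0)$. (iv) The representation $\pi$ of $\mathcal{A}(S^{2n+1}_0)$ on $\ell^2(\mathbb{N}^n\times\mathbb{Z})$ defined in the context extends to a faithful representation of $C(S^{2n+1}_0)$.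
   Context: $\mathbb{N}=\{0,1,2,\dots\}$. $\mathcal{A}(S^{2n+1}_0)$ is the unital associative complex *-algebra generated by $\{z_i,z_i^*\}_{i=0}^n$ with relations: $z_iz_j=0$ for all $i>j$; $z_i^*z_j=0$ for all $i\neq j$; $z_i^*z_i=\sum_{j\geq i}z_jz_j^*$ for all $i$; $\sum_{j=0}^nz_jz_j^*=1$. The group $U(1)$ acts on it by *-automorphisms with $z_i\mapsto uz_i$ for $u\in U(1)$. $C(S^{2n+1}_0)$ is the C*-enveloping algebra of $\mathcal{A}(S^{2n+1}_0)$, i.e. its universal C*-algebra in the category of unital algebras: a unital C*-algebra with a canonical unital *-homomorphism from $\mathcal{A}(S^{2n+1}_0)$ through which every unital *-homomorphism from $\mathcal{A}(S^{2n+1}_0)$ to a unital C*-algebra factors uniquely. $\Sigma_n$ is the directed graph with $n+1$ vertices $v_0,\ldots,v_n$ and one edge $e_{i,j}$ from $v_i$ to $v_j$ for all $0\leq i\leq j\leq n$. For a finite directed graph $E=(E^0,E^1,s,t)$ ($s$ source, $t$ target), the Leavitt path algebra $L_{\mathbb{C}}(E)$ is the universal complex algebra generated by $\{P_v,S_e,S_e^*:v\in E^0,e\in E^1\}$ with relations: $P_vP_w=\delta_{v,w}P_v$; $S_e^*S_f=\delta_{e,f}P_{t(e)}$; $\sum_{e:\,s(e)=v}S_eS_e^*=P_v$ for every $v$ that is not a sink (a sink is a vertex with no outgoing edges); $P_{s(e)}S_e=S_eP_{t(e)}=S_e$; $P_{t(e)}S_e^*=S_e^*P_{s(e)}=S_e^*$.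 It is unital with $1=\sum_vP_v$, and is a *-algebra with $P_v^*=P_v$ and $S_e^*$ the adjoint of $S_e$. The graph C*-algebra $C^*(E)$ is the universal C*-algebra generated by mutually orthogonal projections $\{P_v\}_{v\in E^0}$ and partial isometries $\{S_e\}_{e\in E^1}$ with $S_e^*S_e=P_{t(e)}$ for all $e\in E^1$ and $\sum_{e:\,s(e)=v}S_eS_e^*=P_v$ for every $v$ that is not a sink. $L_{\mathbb{C}}(E)$ is identified with a dense *-subalgebra of $C^*(E)$ via $P_v\mapsto P_v$, $S_e\mapsto S_e$. The gauge action of $U(1)$ is given by $P_v\mapsto P_v$, $S_e\mapsto uS_e$, $u\in U(1)$. The representation $\pi$: let $\{|k_0,\ldots,k_n\rangle:(k_0,\ldots,k_n)\in\mathbb{N}^n\times\mathbb{Z}\}$ be the standard orthonormal basis of $\ell^2(\mathbb{N}^n\times\mathbb{Z})$. Then $\pi(z_i)=Z_i$ is the bounded operator $$Z_i|k_0,\ldots,k_n\rangle=\delta_{k_0,0}\cdots\delta_{k_{i-1},0}\,|0,\ldots,0,k_i+1,k_{i+1},\ldots,k_n\rangle,\qquad 0\leq i\leq n$$ (for $i=0$ the product of deltas is empty, equal to $1$). This is a bounded *-representation of $\mathcal{A}(S^{2n+1}_0)$. A representation of a C*-algebra is faithful if and only if it is injective. *)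

(* Defs.v *)
From HB Require Import structures.
From mathcomp Require Import all_boot all_order all_algebra.
From mathcomp Require Import all_classical all_reals all_analysis.
From mathcomp Require Import complex ring.
From mathcomp Require summability.

Set Implicit Arguments.
Unset Strict Implicit.
Unset Printing Implicit Defensive.

Import Order.TTheory GRing.Theory Num.Theory.
Import numFieldNormedType.Exports.

Local Open Scope classical_set_scope.
Local Open Scope ring_scope.

(* The ring structures of the library are unital; the universal properties of
   Leavitt path algebras and graph C*-algebras quantify over algebras that need
   not have a unit, so the product is a separate operation on a module. *)
HB.mixin Record Lmodule_hasAlgMul (K : numClosedFieldType) A
    of GRing.Lmodule K A := {
  amul : A -> A -> A;
  amulA : associative amul;
  amulDl : left_distributive amul +%R;
  amulDr : right_distributive amul +%R;
  amulZl : forall (a : K) x y, amul (a *: x) y = a *: amul x y;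
  amulZr : forall (a : K) x y, amul x (a *: y) = a *: amul x y
}.

#[short(type="assocAlgType")]
HB.structure Definition AssocAlgebra (K : numClosedFieldType) :=
  {A of GRing.Lmodule K A & Lmodule_hasAlgMul K A}.

Notation "x ** y" := (amul x y) (at level 40, left associativity) : ring_scope.

HB.mixin Record AssocAlgebra_hasStar (K : numClosedFieldType) A
    of AssocAlgebra K A := {
  star : A -> A;
  starK : involutive star;
  starD : {morph star : x y / x + y};
  starZ : forall (a : K) x, star (a *: x) = a^* *: star x;
  starM : forall x y, star (x ** y) = star y ** star x
}.

#[short(type="starAlgType")]
HB.structure Definition StarAlgebra (K : numClosedFieldType) :=
  {A of AssocAlgebra K A & AssocAlgebra_hasStar K A}.

HB.mixin Record AssocAlgebra_hasOne (K : numClosedFieldType) A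
    of AssocAlgebra K A := {
  aone : A;
  amul1l : left_id aone amul;
  amul1r : right_id aone amul
}.

#[short(type="unitalStarAlgType")]
HB.structure Definition UnitalStarAlgebra (K : numClosedFieldType) :=
  {A of StarAlgebra K A & AssocAlgebra_hasOne K A}.

HB.mixin Record isCStarNorm (K : numClosedFieldType) A
    of CompleteNormedModule K A & StarAlgebra K A := {
  norm_amul : forall x y : A, `|x ** y| <= `|x| * `|y|;
  norm_cstar : forall x : A, `|star x ** x| = `|x| ^+ 2
}.

#[short(type="cstarAlgType")]
HB.structure Definition CStarAlgebra (K : numClosedFieldType) :=
  {A of CompleteNormedModule K A & StarAlgebra K A & isCStarNorm K A}.

#[short(type="unitalCStarAlgType")]
HB.structure Definition UnitalCStarAlgebra (K : numClosedFieldType) :=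
  {A of CStarAlgebra K A & AssocAlgebra_hasOne K A}.

Section Morphisms.
Variable K : numClosedFieldType.

Definition alg_hom (A B : assocAlgType K) (f : A -> B) : Prop :=
  linear f /\ {morph f : x y / x ** y}.

Definition star_hom (A B : starAlgType K) (f : A -> B) : Prop :=
  alg_hom f /\ {morph f : x / star x}.

Definition unital_star_hom (A B : unitalStarAlgType K) (f : A -> B) : Prop :=
  star_hom f /\ f (aone : A) = aone.

Definition cstar_envelope (A : unitalStarAlgType K) (C : unitalCStarAlgType K)
    (iota : A -> C) : Prop :=
  unital_star_hom iota /\
  forall (B : unitalCStarAlgType K) (f : A -> B), unital_star_hom f ->
    exists! g : C -> B, unital_star_hom g /\ forall a, g (iota a) = f a.

(* [act u] is only meaningful for [u] on the unit circle. *)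
Definition circle_action (A : starAlgType K) (act : K -> A -> A) : Prop :=
  [/\ forall u, `|u| = 1 -> star_hom (act u) /\ bijective (act u),
      forall x, act 1 x = x
    & forall u v, `|u| = 1 -> `|v| = 1 ->
        forall x, act (u * v) x = act u (act v x)].

End Morphisms.

Section Sphere.
Variables (K : numClosedFieldType) (n : nat).

Definition sphere_relations (A : unitalStarAlgType K) (z : 'I_n.+1 -> A) : Prop :=
  [/\ forall i j : 'I_n.+1, (j < i)%N -> z i ** z j = 0,
      forall i j : 'I_n.+1, i != j -> star (z i) ** z j = 0,
      forall i : 'I_n.+1, star (z i) ** z i =
        \sum_(j < n.+1 | (i <= j)%N) z j ** star (z j)
    & \sum_(j < n.+1) z j ** star (z j) = aone].

(* [A], with generators [z], is the *-algebra A(S^{2n+1}_0). *)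
Definition sphere_algebra (A : unitalStarAlgType K) (z : 'I_n.+1 -> A) : Prop :=
  sphere_relations z /\
  forall (B : unitalStarAlgType K) (y : 'I_n.+1 -> B), sphere_relations y ->
    exists! f : A -> B, unital_star_hom f /\ forall i, f (z i) = y i.

End Sphere.

Record digraph := Digraph {
  vertex : finType;
  edge : finType;
  src : edge -> vertex;
  tgt : edge -> vertex
}.

Definition is_sink (E : digraph) (v : vertex E) : Prop :=
  forall e : edge E, src e != v.

Section SigmaGraph.
Variable n : nat.

Definition Sigma_edge := {p : 'I_n.+1 * 'I_n.+1 | (p.1 <= p.2)%N}.

Definition Sigma : digraph :=
  @Digraph 'I_n.+1 Sigma_edge (fun e => (val e).1) (fun e => (val e).2).

Definition Sigma_e (i j : 'I_n.+1) (le_ij : (i <= j)%N) : edge Sigma :=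
  exist _ (i, j) le_ij.

End SigmaGraph.

Section GraphAlgebras.
Variables (K : numClosedFieldType) (E : digraph).

(* [Sd e] stands for the generator written S_e^*. *)
Definition leavitt_relations (A : assocAlgType K)
    (P : vertex E -> A) (S Sd : edge E -> A) : Prop :=
  (forall v w, P v ** P w = if v == w then P v else 0) /\
  (forall e f, Sd e ** S f = if e == f then P (tgt e) else 0) /\
  (forall v, ~ is_sink v -> \sum_(e | src e == v) S e ** Sd e = P v) /\
  (forall e, P (src e) ** S e = S e /\ S e ** P (tgt e) = S e) /\
  (forall e, P (tgt e) ** Sd e = Sd e /\ Sd e ** P (src e) = Sd e).

(* [L], with generators [P], [S] and [star \o S], is the Leavitt path algebra of
   [E] together with its canonical involution. *)
Definition leavitt_algebra (L : starAlgType K)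
    (P : vertex E -> L) (S : edge E -> L) : Prop :=
  [/\ leavitt_relations P S (fun e => star (S e)),
      forall v, star (P v) = P v
    & forall (B : assocAlgType K) (p : vertex E -> B) (s sd : edge E -> B),
        leavitt_relations p s sd ->
        exists! f : L -> B,
          [/\ alg_hom f, forall v, f (P v) = p v, forall e, f (S e) = s e
            & forall e, f (star (S e)) = sd e]].

Definition cuntz_krieger_family (A : cstarAlgType K)
    (P : vertex E -> A) (S : edge E -> A) : Prop :=
  (forall v, star (P v) = P v /\ P v ** P v = P v) /\
  (forall v w, v != w -> P v ** P w = 0) /\
  (forall e, S e ** star (S e) ** S e = S e) /\
  (forall e, star (S e) ** S e = P (tgt e)) /\
  (forall v, ~ is_sink v -> \sum_(e | src e == v) S e ** star (S e) = P v).

Definition graph_cstar_algebra (G : cstarAlgType K)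
    (P : vertex E -> G) (S : edge E -> G) : Prop :=
  cuntz_krieger_family P S /\
  forall (B : cstarAlgType K) (p : vertex E -> B) (s : edge E -> B),
    cuntz_krieger_family p s ->
    exists! f : G -> B,
      [/\ star_hom f, forall v, f (P v) = p v & forall e, f (S e) = s e].

End GraphAlgebras.

Section Ell2.
Variables (R : realType) (I : choiceType).
Local Notation C := R[i].

Definition sqmod (w : C) : R := complex.Re w ^+ 2 + complex.Im w ^+ 2.

Lemma sqmod_ge0 w : 0 <= sqmod w.
Proof. by rewrite addr_ge0 ?sqr_ge0. Qed.

Lemma sqmodD w w' : sqmod (w + w') <= 2 * sqmod w + 2 * sqmod w'.
Proof.
case: w w' => [a b] [c d]; rewrite /sqmod /= -subr_ge0.
rewrite (_ : _ - _ = (a - c) ^+ 2 + (b - d) ^+ 2).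
  by rewrite addr_ge0 ?sqr_ge0.
by ring.
Qed.

Lemma sqmodM w w' : sqmod (w * w') = sqmod w * sqmod w'.
Proof. by case: w w' => [a b] [c d]; rewrite /sqmod /=; ring. Qed.

Lemma sqmod0 : sqmod 0 = 0.
Proof. by rewrite /sqmod /= expr0n /= addr0. Qed.

Definition sqnorm (f : I -> C) : \bar R := \esum_(i in [set: I]) (sqmod (f i))%:E.

Lemma sqnorm_ge0 f : (0 <= sqnorm f)%E.
Proof. by apply: esum_ge0 => i _; rewrite lee_fin sqmod_ge0. Qed.

Lemma sqnormZ_le (c : C) (f : I -> C) :
  (sqnorm (fun i => (c * f i)%R) <= (sqmod c)%:E * sqnorm f)%E.
Proof.
apply: ge_ereal_sup => _ [X fX <-].
rewrite (eq_fsbigr (fun i => (sqmod c)%:E * (sqmod (f i))%:E)%E); last first.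
  by move=> i _; rewrite sqmodM EFinM.
rewrite -ge0_mule_fsumr; last by move=> i; rewrite lee_fin sqmod_ge0.
apply: lee_wpmul2l; first by rewrite lee_fin sqmod_ge0.
by apply: ereal_sup_ubound; exists X.
Qed.

Definition ell2_pred : {pred (I -> C^o)} := [pred f | (sqnorm f < +oo)%E].

Lemma ell2_submod_closed : submod_closed ell2_pred.
Proof.
split.
  by rewrite inE /sqnorm esum1 ?ltry// => i _; rewrite sqmod0.
move=> c f g; rewrite !inE => fI gI.
have two_ge0 : (0 <= 2%:E :> \bar R)%E by rewrite lee_fin.
have fin2 h : (sqnorm h < +oo -> \esum_(i in [set: I]) (2%:E * (sqmod (h i))%:E) < +oo)%E.
  move=> hI; rewrite (eq_esum (b := fun i => ((sqmod (h i))%:E + (sqmod (h i))%:E)%E)).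
    rewrite esumD; first by rewrite lte_add_pinfty.
    - by move=> i _; rewrite lee_fin sqmod_ge0.
    - by move=> i _; rewrite lee_fin sqmod_ge0.
  by move=> i _; rewrite -EFinM -EFinD; congr EFin; ring.
have cfI : (sqnorm (fun i => (c * f i)%R) < +oo)%E.
  apply: le_lt_trans (sqnormZ_le c f) _.
  have /fineK <- : sqnorm f \is a fin_num by rewrite ge0_fin_numE// sqnorm_ge0.
  by rewrite -EFinM ltry.
apply: (@le_lt_trans _ _ (\esum_(i in [set: I])
    (2%:E * (sqmod (c * f i)%R)%:E + 2%:E * (sqmod (g i))%:E))%E).
  apply: le_esum => i _; rewrite -!EFinM -EFinD lee_fin; exact: sqmodD.
rewrite esumD; last 2 first.
- by move=> i _; rewrite mule_ge0// lee_fin sqmod_ge0.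
- by move=> i _; rewrite mule_ge0// lee_fin sqmod_ge0.
by rewrite lte_add_pinfty// fin2.
Qed.

HB.instance Definition _ :=
  GRing.isSubmodClosed.Build C (I -> C^o) ell2_pred ell2_submod_closed.

Record ell2 := Ell2 { ell2_val :> I -> C^o; _ : ell2_val \in ell2_pred }.
HB.instance Definition _ := [isSub for ell2_val].
HB.instance Definition _ := [Choice of ell2 by <:].
HB.instance Definition _ := [SubChoice_isSubLmodule of ell2 by <:].

Lemma ket_subproof (k : I) : (fun i => (i == k)%:R : C^o) \in ell2_pred.
Proof.
rewrite inE /sqnorm (eq_esum (b := fun i => if i \in [set k] then 1%E else 0%E)).
  by rewrite -esum_mkcond esum_set1// ltry.
move=> i _; rewrite (_ : (i \in [set k]) = (i == k)); last first.
  by apply/idP/eqP => [/set_mem|->] //; exact: mem_set.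
case: eqP => _ /=; last by rewrite sqmod0.
by rewrite /sqmod /= expr1n expr0n /= addr0.
Qed.

Definition ket (k : I) : ell2 := Ell2 (ket_subproof k).

Definition ell2_norm (f : ell2) : R := Num.sqrt (fine (sqnorm f)).

(* Antilinear in the first argument; the sum is the limit of the finite partial
   sums along the directed set of finite subsets of [I]. *)
Definition ell2_inner (f g : ell2) : C :=
  summability.sum (fun i => (f i)^* * g i : C^o).

Definition bounded_operator (T : ell2 -> ell2) : Prop :=
  linear T /\ exists M : R, forall f, ell2_norm (T f) <= M * ell2_norm f.

Definition star_representation (A : unitalStarAlgType C)
    (rho : A -> ell2 -> ell2) : Prop :=
  (forall a, bounded_operator (rho a)) /\
  (forall (c : C) a b f, rho (c *: a + b) f = c *: rho a f + rho b f) /\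
  (forall a b f, rho (a ** b) f = rho a (rho b f)) /\
  (forall f, rho aone f = f) /\
  (forall a f g, ell2_inner (rho (star a) f) g = ell2_inner f (rho a g)).

End Ell2.

(* The last component of a basis index (k_0, ..., k_n) is the integer k_n. *)
Definition basis_index (n : nat) : Type := ({ffun 'I_n -> nat} * int)%type.
HB.instance Definition _ n := Choice.on (basis_index n).

Definition basis_incr n (i : 'I_n.+1) (k : basis_index n) : basis_index n :=
  ([ffun j : 'I_n => (k.1 j + (i == j :> nat))%N], k.2 + (i == n :> nat)%:Z).

(* [Z_i |k>]: the Kronecker deltas only involve indices j < i <= n, hence only
   natural-number components. *)
Definition shift_ket (R : realType) n (i : 'I_n.+1) (k : basis_index n) :
    ell2 R (basis_index n) :=
  if [forall j : 'I_n, (j < i)%N ==> (k.1 j == 0%N)]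
  then ket R (basis_incr i k) else 0.

(* Main.v *)
Require Import Defs.
From HB Require Import structures.
From mathcomp Require Import all_boot all_order all_algebra.
From mathcomp Require Import finmap.
From mathcomp Require Import all_classical all_reals all_analysis.
From mathcomp Require Import complex ring lra zify.
From mathcomp Require summability.

(** Parts (ii) and (iii) are comparisons of universal properties. The elements
    [z_i z_i^*] and [z_i z_j z_j^*] satisfy the relations of the Leavitt path
    algebra, the elements [sum_j S_(e_ij)] satisfy those of the sphere, and the
    two resulting morphisms are inverse to each other because they are so on
    generators ([leavitt_sphere_iso]). The C*-completions are then exchanged in
    the same way ([graph_envelope_iso]). The universal objects attached to the
    graph live among algebras without a unit; that the sum of the vertex
    projections is a unit there is itself a consequence of uniqueness
    ([unit_of_rigid]).

    Parts (i) and (iv) say that [pi] is injective on the sphere algebra and that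
    no unital morphism [f] to a C*-algebra gives an element a larger norm than
    [pi] does: [|f a| <= |pi a|] ([sphere_norm_le]). Given this, (iv) follows by
    mapping the envelope to the closure of the pairs [(iota a, pi a)] in the
    direct sum of the envelope and the bounded operators
    ([envelope_faithful]).

    The norm inequality is obtained from a weaker one by a power trick. It is
    enough to find a constant [c(d)], polynomial in [d], with
    [|f b| <= c(d) |pi b|] for all [b] of degree at most [d]: for
    [b = (a^* a)^(2^k)] the C*-identity turns both sides into powers with exponent
    [2^(k+1)] of [|f a|] and [|pi a|], while [c] only grows like a polynomial
    in [2^k], so the constant becomes 1 as [k] goes to infinity
    ([le_of_polynomial_powers]).

    For the weak inequality, write [q_i = z_i^* z_i]; the sphere relations say
    that [q_0 = 1], [q_i = z_i z_i^* + q_(i+1)] and [q_(n+1) = 0]. An element of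
    the corner of [q_i] of degree at most [d] has the form
    [sum_(p, q <= d) z_i^p (c_pq q_i + T_pq) z_i^*q] with scalars [c_pq] that
    vanish unless [p = 0] or [q = 0] and with [T_pq] in the corner of [q_(i+1)]
    ([tspan_mul], [tspan_normal_form]). The [T_pq] are compressions of the
    element, up to the [c_pq] ([corner_entry_normal_form]), and the [c_pq] are
    matrix coefficients of its image under [pi], taken far out on the half-line
    where [z_i] acts as a shift ([shift_coeff_le]). So both are bounded in terms
    of [|pi b|], and the generators are contractions under [f]; descending
    through the [n + 1] levels gives the weak inequality ([tspan_norm_le]), and,
    when [pi b = 0], also [b = 0] ([tspan_norm_eq0]). *)

Set Implicit Arguments.
Unset Strict Implicit.
Unset Printing Implicit Defensive.

Import Order.TTheory GRing.Theory Num.Theory.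
Import numFieldNormedType.Exports.
Local Open Scope classical_set_scope.
Local Open Scope complex_scope.
Local Open Scope ring_scope.

(** * Calculus in associative and star algebras *)

Section AssocTheory.
Variables (K : numClosedFieldType) (A : assocAlgType K).
Implicit Types x y : A.

Lemma amul0l x : 0 ** x = 0.
Proof. by have := amulZl (0 : K) 0 x; rewrite !scale0r. Qed.

Lemma amul0r x : x ** 0 = 0.
Proof. by have := amulZr (0 : K) x 0; rewrite !scale0r. Qed.

Lemma amulNl x y : (- x) ** y = - (x ** y).
Proof. by rewrite -scaleN1r amulZl scaleN1r. Qed.

Lemma amulNr x y : x ** (- y) = - (x ** y).
Proof. by rewrite -scaleN1r amulZr scaleN1r. Qed.

Lemma amulBl x y w : (x - y) ** w = x ** w - y ** w.
Proof. by rewrite amulDl amulNl. Qed.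

Lemma amulBr x y w : w ** (x - y) = w ** x - w ** y.
Proof. by rewrite amulDr amulNr. Qed.

Lemma amul_sumr (J : Type) (r : seq J) (Q : pred J) (F : J -> A) x :
  x ** (\sum_(j <- r | Q j) F j) = \sum_(j <- r | Q j) x ** F j.
Proof. exact: (big_morph _ (amulDr x) (amul0r x)). Qed.

Lemma amul_suml (J : Type) (r : seq J) (Q : pred J) (F : J -> A) x :
  (\sum_(j <- r | Q j) F j) ** x = \sum_(j <- r | Q j) F j ** x.
Proof. exact: (big_morph (fun y => y ** x) (fun a b => amulDl a b x) (amul0l x)). Qed.

End AssocTheory.

Lemma scale2B (K : numClosedFieldType) (V : lmodType K) (x : V) :
  2 *: x - x = x.
Proof. by rewrite scaler_nat mulr2n addrK. Qed.

Section LinearMaps.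
Variables (K : numClosedFieldType) (U V : lmodType K) (f : U -> V).
Hypothesis lin_f : linear f.

Lemma lin0 : f 0 = 0.
Proof. by have := lin_f (-1) 0 0; rewrite scaler0 addr0 scaleN1r addNr. Qed.

Lemma linD x y : f (x + y) = f x + f y.
Proof. by have := lin_f 1 x y; rewrite !scale1r. Qed.

Lemma linZ c x : f (c *: x) = c *: f x.
Proof. by have := lin_f c x 0; rewrite lin0 !addr0. Qed.

Lemma linB x y : f (x - y) = f x - f y.
Proof. by rewrite linD -scaleN1r linZ scaleN1r. Qed.

Lemma lin_sum (J : Type) (r : seq J) (Q : pred J) (F : J -> U) :
  f (\sum_(j <- r | Q j) F j) = \sum_(j <- r | Q j) f (F j).
Proof. exact: (big_morph _ linD lin0). Qed.

End LinearMaps.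

Section StarTheory.
Variables (K : numClosedFieldType) (A : starAlgType K).
Implicit Types x y : A.

Lemma star0 : star (0 : A) = 0.
Proof. by have := starZ (0 : K) (0 : A); rewrite conjC0 !scale0r. Qed.

Lemma starN x : star (- x) = - star x.
Proof. by rewrite -scaleN1r starZ rmorphN1 scaleN1r. Qed.

Lemma starB x y : star (x - y) = star x - star y.
Proof. by rewrite starD starN. Qed.

Lemma star_sum (J : Type) (r : seq J) (Q : pred J) (F : J -> A) :
  star (\sum_(j <- r | Q j) F j) = \sum_(j <- r | Q j) star (F j).
Proof. exact: (big_morph _ (@starD K A) star0). Qed.

End StarTheory.

Lemma star1 (K : numClosedFieldType) (A : unitalStarAlgType K) :
  star (aone : A) = aone.
Proof. by rewrite -[LHS]amul1l -[X in X ** _]starK -starM amul1l starK. Qed.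

(** * Morphisms *)

Section HomTheory.
Variable K : numClosedFieldType.

Lemma alg_hom_id (A : assocAlgType K) : alg_hom (id : A -> A).
Proof. by split. Qed.

Lemma alg_hom_comp (A B D : assocAlgType K) (f : A -> B) (g : B -> D) :
  alg_hom f -> alg_hom g -> alg_hom (g \o f).
Proof.
move=> [lf mf] [lg mg]; split=> [c x y|x y] /=; first by rewrite lf lg.
by rewrite mf mg.
Qed.

Lemma star_hom_id (A : starAlgType K) : star_hom (id : A -> A).
Proof. by split. Qed.

Lemma star_hom_comp (A B D : starAlgType K) (f : A -> B) (g : B -> D) :
  star_hom f -> star_hom g -> star_hom (g \o f).
Proof.
move=> [af sf] [ag sg]; split; first exact: alg_hom_comp.
by move=> x /=; rewrite sf sg.
Qed.

Lemma unital_star_hom_id (A : unitalStarAlgType K) :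
  unital_star_hom (id : A -> A).
Proof. by split. Qed.

Lemma unital_star_hom_comp (A B D : unitalStarAlgType K)
    (f : A -> B) (g : B -> D) :
  unital_star_hom f -> unital_star_hom g -> unital_star_hom (g \o f).
Proof.
move=> [hf f1] [hg g1]; split; first exact: star_hom_comp.
by rewrite /= f1.
Qed.

(** Conjugating an algebra morphism by the involutions gives an algebra
    morphism again, the two antilinearities and the two reversals of products
    cancelling out; it is how a uniqueness statement for algebra morphisms
    shows that one of them preserves adjoints. *)
Lemma alg_hom_star_conj (A B : starAlgType K) (f : A -> B) :
  alg_hom f -> alg_hom (fun x => star (f (star x))).
Proof.
move=> [lf mf]; split=> [c x y|x y].
  by rewrite starD starZ lf starD starZ conjCK.
by rewrite starM mf starM.
Qed.

Lemma leavitt_relations_hom (E : digraph) (A B : assocAlgType K) (f : A -> B)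
    (p : vertex E -> A) (s sd : edge E -> A) :
  alg_hom f -> leavitt_relations p s sd ->
  leavitt_relations (f \o p) (f \o s) (f \o sd).
Proof.
move=> [lf mf] [r1 [r2 [r3 [r4 r5]]]]; do 4?split => /=.
- by move=> v w; rewrite -mf r1; case: eqP => // _; rewrite lin0.
- by move=> d e; rewrite -mf r2; case: eqP => // _; rewrite lin0.
- move=> v /r3 <-; rewrite lin_sum //; apply: eq_bigr => e _; exact/esym/mf.
- by move=> e; rewrite -!mf; have [-> ->] := r4 e.
- by move=> e; rewrite -!mf; have [-> ->] := r5 e.
Qed.

Lemma cuntz_krieger_hom (E : digraph) (A B : cstarAlgType K) (f : A -> B)
    (p : vertex E -> A) (s : edge E -> A) :
  star_hom f -> cuntz_krieger_family p s ->
  cuntz_krieger_family (f \o p) (f \o s).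
Proof.
move=> [[lf mf] sf] [r1 [r2 [r3 [r4 r5]]]]; do 4?split => /=.
- by rewrite -sf; have [-> _] := r1 v.
- by rewrite -mf; have [_ ->] := r1 v.
- by move=> v w /r2; rewrite -mf => ->; rewrite lin0.
- by move=> e; rewrite -sf -!mf r3.
- by move=> e; rewrite -sf -mf r4.
- move=> v /r5 <-; rewrite lin_sum //; apply: eq_bigr => e _.
  by rewrite mf sf.
Qed.

Lemma sphere_relations_hom (n : nat) (A B : unitalStarAlgType K) (f : A -> B)
    (z : 'I_n.+1 -> A) :
  unital_star_hom f -> sphere_relations z -> sphere_relations (f \o z).
Proof.
move=> [[[lf mf] sf] f1] [r1 r2 r3 r4]; split=> /=.
- by move=> i j /r1; rewrite -mf => ->; rewrite lin0.
- by move=> i j /r2; rewrite -sf -mf => ->; rewrite lin0.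
- move=> i; rewrite -sf -mf r3 lin_sum //; apply: eq_bigr => j _.
  by rewrite mf sf.
- rewrite -f1 -r4 lin_sum //; apply: eq_bigr => j _; by rewrite mf sf.
Qed.

End HomTheory.

(** Each uniqueness below is that of the universal property, applied to the
    images of the generators: relations are preserved by morphisms. *)
Section UniversalUniqueness.
Variable K : numClosedFieldType.

Lemma leavitt_hom_ext (E : digraph) (L : starAlgType K) (P : vertex E -> L)
    (S : edge E -> L) (B : assocAlgType K) (f g : L -> B) :
  leavitt_algebra P S -> alg_hom f -> alg_hom g ->
  (forall v, f (P v) = g (P v)) -> (forall e, f (S e) = g (S e)) ->
  (forall e, f (star (S e)) = g (star (S e))) -> f =1 g.
Proof.
move=> [rel _ univ] hf hg fP fS fSd x.
have [h [_ h_uniq]] := univ B _ _ _ (leavitt_relations_hom hg rel).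
have <- : h = f by apply: h_uniq; split.
by have <- : h = g by apply: h_uniq; split.
Qed.

Lemma graph_hom_ext (E : digraph) (G : cstarAlgType K) (P : vertex E -> G)
    (S : edge E -> G) (B : cstarAlgType K) (f g : G -> B) :
  graph_cstar_algebra P S -> star_hom f -> star_hom g ->
  (forall v, f (P v) = g (P v)) -> (forall e, f (S e) = g (S e)) -> f =1 g.
Proof.
move=> [rel univ] hf hg fP fS x.
have [h [_ h_uniq]] := univ B _ _ (cuntz_krieger_hom hg rel).
have <- : h = f by apply: h_uniq; split.
by have <- : h = g by apply: h_uniq; split.
Qed.

Lemma sphere_hom_ext (n : nat) (A : unitalStarAlgType K) (z : 'I_n.+1 -> A)
    (B : unitalStarAlgType K) (f g : A -> B) :
  sphere_algebra z -> unital_star_hom f -> unital_star_hom g ->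
  (forall i, f (z i) = g (z i)) -> f =1 g.
Proof.
move=> [rel univ] hf hg fz x.
have [h [_ h_uniq]] := univ B _ (sphere_relations_hom hg rel).
have <- : h = f by apply: h_uniq; split.
by have <- : h = g by apply: h_uniq; split.
Qed.

Lemma envelope_hom_ext (A : unitalStarAlgType K) (C : unitalCStarAlgType K)
    (iota : A -> C) (B : unitalCStarAlgType K) (f g : C -> B) :
  cstar_envelope iota -> unital_star_hom f -> unital_star_hom g ->
  (forall a, f (iota a) = g (iota a)) -> f =1 g.
Proof.
move=> [hi univ] hf hg fi x.
have [h [_ h_uniq]] := univ B _ (unital_star_hom_comp hi hg).
have <- : h = f by apply: h_uniq; split.
by have <- : h = g by apply: h_uniq; split.
Qed.

End UniversalUniqueness.

(** * A unit from rigidity *)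

Section UnitOfRigid.
Variables (K : numClosedFieldType) (A : starAlgType K) (e : A) (X : set A).
Hypotheses (e_star : star e = e) (e_idem : e ** e = e).
Hypothesis e_unit_on : forall x, X x -> e ** x = x /\ x ** e = x.
Hypothesis rigid : forall f : A -> A,
  star_hom f -> (forall x, X x -> f x = x) -> forall x, f x = x.

(* Left and right multiplication by the formal unitary 2e - 1. *)
Let lrefl (x : A) := 2 *: (e ** x) - x.
Let rrefl (x : A) := 2 *: (x ** e) - x.

Let lrefl_linear : linear lrefl.
Proof.
move=> c x y; rewrite /lrefl amulDr amulZr scalerDr scalerBr opprD addrACA.
by rewrite !scalerA mulrC.
Qed.

Let rrefl_linear : linear rrefl.
Proof.
move=> c x y; rewrite /rrefl amulDl amulZl scalerDr scalerBr opprD addrACA.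
by rewrite !scalerA mulrC.
Qed.

Let lreflM x y : lrefl (x ** y) = lrefl x ** y.
Proof. by rewrite /lrefl amulBl amulZl amulA. Qed.

Let rreflM x y : rrefl (x ** y) = x ** rrefl y.
Proof. by rewrite /rrefl amulBr amulZr amulA. Qed.

Let rlreflM x y : rrefl x ** y = x ** lrefl y.
Proof. by rewrite /rrefl /lrefl amulBl amulBr amulZl amulZr amulA. Qed.

Let lreflK x : lrefl (lrefl x) = x.
Proof.
rewrite /lrefl amulBr amulZr amulA e_idem; set w := e ** x.
by rewrite scale2B subKr.
Qed.

Let lrreflC x : lrefl (rrefl x) = rrefl (lrefl x).
Proof.
by rewrite {1}/rrefl (linB lrefl_linear) (linZ lrefl_linear) lreflM.
Qed.

Let star_rrefl x : star (rrefl x) = lrefl (star x).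
Proof.
by rewrite /rrefl /lrefl starB starZ starM e_star conjC_nat.
Qed.

Let star_lrefl x : star (lrefl x) = rrefl (star x).
Proof. by rewrite -[x in LHS]starK -star_rrefl starK. Qed.

Let conj_hom : star_hom (fun x => lrefl (rrefl x)).
Proof.
split; first split.
- by move=> c x y; rewrite rrefl_linear lrefl_linear.
- by move=> x y; rewrite rreflM lreflM -lreflM -[in RHS]lreflM rlreflM lreflK.
- by move=> x; rewrite star_lrefl star_rrefl lrreflC.
Qed.

(** Conjugation by the self-adjoint unitary [2e - 1] of the unitization maps
    the algebra to itself and fixes [X], so it is the identity by rigidity,
    and [e] is central; then [x |-> e x] is a morphism that fixes [X] too. *)
Lemma unit_of_rigid x : e ** x = x /\ x ** e = x.
Proof.
have central y : e ** y = y ** e.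
  have : lrefl (rrefl y) = y.
    apply: rigid conj_hom _ _ => w /e_unit_on [ew we].
    by rewrite /rrefl we scale2B /lrefl ew scale2B.
  move/(congr1 lrefl); rewrite lreflK /lrefl /rrefl => /addIr /scalerI.
  by rewrite pnatr_eq0 => ->.
have mul_e y : e ** y = y.
  apply: (rigid (f := fun y => e ** y)) => [|w /e_unit_on []//].
  split; first split.
  - by move=> c u v; rewrite amulDr amulZr.
  - by move=> u v; rewrite [LHS]amulA !(central u) -!amulA (amulA e e) e_idem.
  - by move=> u; rewrite central starM e_star.
by split=> //; rewrite -central.
Qed.

End UnitOfRigid.

(** In both cases uniqueness of morphisms makes the identity the only
    endomorphism that fixes the generators. *)
Section LeavittUnit.
Variables (K : numClosedFieldType) (E : digraph).

Lemma vertex_sum_unit_on (A : assocAlgType K) (P : vertex E -> A)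
    (S Sd : edge E -> A) (x : A) :
  leavitt_relations P S Sd ->
  [\/ exists v, x = P v, exists e, x = S e | exists e, x = Sd e] ->
  (\sum_v P v) ** x = x /\ x ** (\sum_v P v) = x.
Proof.
move=> [PP [_ [_ [PS PSd]]]].
have sumP v : (\sum_v P v) ** P v = P v.
  rewrite amul_suml (bigD1 v) //= PP eqxx big1 ?addr0 // => w /negbTE wv.
  by rewrite PP wv.
have Psum v : P v ** (\sum_v P v) = P v.
  rewrite amul_sumr (bigD1 v) //= PP eqxx big1 ?addr0 // => w /negbTE wv.
  by rewrite PP eq_sym wv.
case=> -[v ->]; split=> //.
- by rewrite -(PS v).1 amulA sumP.
- by rewrite -(PS v).2 -amulA Psum.
- by rewrite -(PSd v).1 amulA sumP.
- by rewrite -(PSd v).2 -amulA Psum.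
Qed.

Lemma leavitt_unit (L : starAlgType K) (P : vertex E -> L) (S : edge E -> L) :
  leavitt_algebra P S ->
  forall x, (\sum_v P v) ** x = x /\ x ** (\sum_v P v) = x.
Proof.
move=> LP; have [rel starP _] := LP.
have e_on x := @vertex_sum_unit_on _ _ _ _ x rel.
apply: unit_of_rigid e_on _.
- by rewrite star_sum; apply: eq_bigr.
- rewrite amul_sumr; apply: eq_bigr => v _.
  by apply: (vertex_sum_unit_on rel _).1; constructor 1; exists v.
move=> f [hf _] fX; apply: (leavitt_hom_ext LP hf (@alg_hom_id _ _)).
- by move=> v; apply: fX; constructor 1; exists v.
- by move=> e; apply: fX; constructor 2; exists e.
- by move=> e; apply: fX; constructor 3; exists e.
Qed.

Lemma graph_unit (G : cstarAlgType K) (P : vertex E -> G) (S : edge E -> G) :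
  graph_cstar_algebra P S -> leavitt_relations P S (fun e => star (S e)) ->
  forall x, (\sum_v P v) ** x = x /\ x ** (\sum_v P v) = x.
Proof.
move=> GP rel; have [[starP _] _] := GP.
have e_on x := @vertex_sum_unit_on _ _ _ _ x rel.
apply: unit_of_rigid e_on _.
- by rewrite star_sum; apply: eq_bigr => v _; have [] := starP v.
- rewrite amul_sumr; apply: eq_bigr => v _.
  by apply: (vertex_sum_unit_on rel _).1; constructor 1; exists v.
move=> f hf fX; apply: (graph_hom_ext GP hf (@star_hom_id _ _)).
- by move=> v; apply: fX; constructor 1; exists v.
- by move=> e; apply: fX; constructor 2; exists e.
Qed.

Lemma cuntz_krieger_of_leavitt (B : cstarAlgType K) (P : vertex E -> B)
    (S : edge E -> B) :
  leavitt_relations P S (fun e => star (S e)) ->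
  (forall v, star (P v) = P v) -> cuntz_krieger_family P S.
Proof.
move=> [PP [SS [sumS [PS _]]]] starP; do 4?split=> //.
- by rewrite PP eqxx.
- by move=> v w /negbTE vw; rewrite PP vw.
- by move=> e; rewrite -amulA SS eqxx; have [] := PS e.
- by move=> e; rewrite SS eqxx.
Qed.

End LeavittUnit.

(** * The graph and the sphere presentations *)

Section SphereRelations.
Variables (K : numClosedFieldType) (n : nat) (A : unitalStarAlgType K).
Variable (z : 'I_n.+1 -> A).
Hypothesis z_rel : sphere_relations z.
Implicit Types i j : 'I_n.+1.

Let p i := z i ** star (z i).

Lemma star_range_proj i : star (p i) = p i.
Proof. by rewrite starM starK. Qed.

Lemma sphere_source_proj i : z i ** (star (z i) ** z i) = z i.
Proof.
have [zz _ zsz zsum] := z_rel.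
rewrite zsz -[in RHS](amul1r (z i)) -zsum !amul_sumr.
rewrite [RHS](bigID (fun j : 'I_n.+1 => (i <= j)%N)) /=.
rewrite [X in _ = _ + X]big1 ?addr0 // => j; rewrite -ltnNge => ji.
by rewrite amulA zz // amul0l.
Qed.

Lemma range_proj_mul i j : p i ** p j = if i == j then p i else 0.
Proof.
have [_ zsz _ _] := z_rel; rewrite /p amulA -(amulA (z i)).
case: (eqVneq i j) => [->|/zsz ->]; first by rewrite sphere_source_proj.
by rewrite amul0r amul0l.
Qed.

Lemma range_source_proj i j : (i <= j)%N -> p j ** (star (z i) ** z i) = p j.
Proof.
have [_ _ -> _] := z_rel => ij; rewrite amul_sumr (bigD1 j) //=.
rewrite -/(p j) range_proj_mul eqxx big1 ?addr0 // => k /andP[_ kj].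
by rewrite range_proj_mul eq_sym (negbTE kj).
Qed.

End SphereRelations.

(* Edges of [Sigma n] are pairs; simplification must not expose this. *)
#[local] Arguments src : simpl never.
#[local] Arguments tgt : simpl never.

Section SigmaEdges.
Variable n : nat.
Implicit Types e f : edge (Sigma n).

Lemma Sigma_edge_le e : (src e <= tgt e)%N.
Proof. exact: (valP e). Qed.

Lemma Sigma_edge_eq e f : (e == f) = (src e == src f) && (tgt e == tgt f).
Proof.
by rewrite -val_eqE /src /tgt /=; case: (val e) (val f) => [? ?] [? ?].
Qed.

Lemma Sigma_no_sink (v : vertex (Sigma n)) : ~ is_sink v.
Proof. by move/(_ (Sigma_e (leqnn v))); rewrite /src eqxx. Qed.

Lemma Sigma_sum_from (V : nmodType) (i : 'I_n.+1) (F : 'I_n.+1 -> V) :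
  \sum_(e : edge (Sigma n) | src e == i) F (tgt e)
  = \sum_(j < n.+1 | (i <= j)%N) F j.
Proof.
pose h (j : 'I_n.+1) : edge (Sigma n) := insubd (Sigma_e (leqnn i)) (i, j).
have hK (j : 'I_n.+1) : (i <= j)%N -> src (h j) = i /\ tgt (h j) = j.
  by move=> ij; rewrite /src /tgt /= insubdK.
rewrite (reindex_onto (@tgt (Sigma n)) h); last by move=> j /hK [].
apply: eq_bigl => e; apply/eqP/andP => [ei|[ie /eqP <-]]; last first.
  by have [] := hK _ ie.
have ie : (i <= tgt e)%N by rewrite -ei Sigma_edge_le.
by split=> //; rewrite Sigma_edge_eq; have [-> ->] := hK _ ie; rewrite ei !eqxx.
Qed.

End SigmaEdges.

Section GraphToSphere.
Variables (K : numClosedFieldType) (n : nat) (A : unitalStarAlgType K).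
Variable (z : 'I_n.+1 -> A).
Hypothesis z_rel : sphere_relations z.

Definition sphere_vertex (i : vertex (Sigma n)) : A := z i ** star (z i).
Definition sphere_edge (e : edge (Sigma n)) : A :=
  z (src e) ** z (tgt e) ** star (z (tgt e)).

Lemma sphere_leavitt :
  leavitt_relations sphere_vertex sphere_edge (fun e => star (sphere_edge e)).
Proof.
have [zz zsz zszE zsum] := z_rel.
pose p i := z i ** star (z i).
have sE e : sphere_edge e = z (src e) ** p (tgt e).
  by rewrite /sphere_edge amulA.
have sdE e : star (sphere_edge e) = p (tgt e) ** star (z (src e)).
  by rewrite sE starM star_range_proj.
have pp i : p i ** p i = p i by rewrite (range_proj_mul z_rel) eqxx.
have pz i : p i ** z i = z i by rewrite -amulA sphere_source_proj.
have zsp i : star (z i) ** p i = star (z i).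
  by rewrite -[X in _ = star X]pz starM star_range_proj.
do 4?split.
- by move=> v w; rewrite /sphere_vertex (range_proj_mul z_rel).
- move=> e f; rewrite sdE sE Sigma_edge_eq amulA -(amulA (p _)).
  case: (eqVneq (src e) (src f)) => [<-|/zsz ->] /=; last first.
    by rewrite amul0r amul0l.
  rewrite (range_source_proj z_rel) ?Sigma_edge_le // (range_proj_mul z_rel).
  by [].
- move=> v _.
  under eq_bigr => e /eqP ev do rewrite sdE sE ev amulA -(amulA (z v)) pp.
  rewrite (Sigma_sum_from v (fun j => z v ** p j ** star (z v))).
  by rewrite -amul_suml -amul_sumr -zszE sphere_source_proj.
- move=> e; rewrite sE -[sphere_vertex]/p; split; first by rewrite amulA pz.
  by rewrite -amulA pp.
- move=> e; rewrite sdE -[sphere_vertex]/p; split; first by rewrite amulA pp.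
  by rewrite -amulA zsp.
Qed.

End GraphToSphere.

Section SphereToGraph.
Variables (K : numClosedFieldType) (n : nat) (L : unitalStarAlgType K).
Variables (P : vertex (Sigma n) -> L) (S : edge (Sigma n) -> L).
Hypothesis rel : leavitt_relations P S (fun e => star (S e)).
Hypothesis P_star : forall v, star (P v) = P v.
Hypothesis P_sum : \sum_v P v = aone.

Definition graph_coord (i : 'I_n.+1) : L :=
  \sum_(e : edge (Sigma n) | src e == i) S e.

Let PP := let: conj h _ := rel in h.

Let edge_mul e f : tgt e != src f -> S e ** S f = 0.
Proof.
have [_ [_ [_ [PS _]]]] := rel => ef.
by rewrite -(PS e).2 -(PS f).1 amulA -(amulA (S e)) PP (negbTE ef) amul0r amul0l.
Qed.

Let edge_mul_star e f : tgt e != tgt f -> S e ** star (S f) = 0.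
Proof.
have [_ [_ [_ [PS PSd]]]] := rel => ef.
by rewrite -(PS e).2 -(PSd f).1 amulA -(amulA (S e)) PP (negbTE ef) amul0r amul0l.
Qed.

Lemma graph_coord_mul_star i : graph_coord i ** star (graph_coord i) = P i.
Proof.
have [_ [_ [sumS _]]] := rel.
rewrite -(sumS i (@Sigma_no_sink n i)) /graph_coord star_sum amul_suml.
apply: eq_bigr => e /eqP ei; rewrite amul_sumr (bigD1 e) /= ?ei //.
rewrite big1 ?addr0 // => f /andP[/eqP fi fe]; apply: edge_mul_star.
by apply: contraNneq fe => ef; rewrite Sigma_edge_eq fi ei ef !eqxx.
Qed.

Lemma graph_coord_proj (i j : 'I_n.+1) (le_ij : (i <= j)%N) :
  graph_coord i ** P j = S (Sigma_e le_ij).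
Proof.
have [_ [_ [_ [PS _]]]] := rel.
rewrite /graph_coord amul_suml (bigD1 (Sigma_e le_ij)) //=.
rewrite (PS (Sigma_e le_ij)).2 big1 ?addr0 // => e /andP[/eqP ei ne].
rewrite -(PS e).2 -amulA PP; case: eqVneq => ej; last by rewrite amul0r.
by rewrite Sigma_edge_eq ei ej /src /tgt /= !eqxx in ne.
Qed.

Lemma graph_sphere : sphere_relations graph_coord.
Proof.
have [_ [SS [sumS [PS _]]]] := rel.
split.
- move=> i j ji; rewrite /graph_coord amul_suml big1 // => e /eqP ei.
  rewrite amul_sumr big1 // => f /eqP fj; apply: edge_mul.
  rewrite fj; apply: contraTneq ji => <-.
  by rewrite -leqNgt -ei Sigma_edge_le.
- move=> i j ij; rewrite /graph_coord star_sum amul_suml big1 // => e /eqP ei.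
  rewrite amul_sumr big1 // => f /eqP fj.
  by rewrite SS Sigma_edge_eq ei fj (negbTE ij).
- move=> i; under [RHS]eq_bigr => j _ do rewrite graph_coord_mul_star.
  rewrite -(Sigma_sum_from i P) /graph_coord star_sum amul_suml.
  apply: eq_bigr => e /eqP ei; rewrite amul_sumr (bigD1 e) /= ?ei //.
  rewrite SS eqxx big1 ?addr0 // => f /andP[_ fe].
  by rewrite SS eq_sym (negbTE fe).
- by rewrite -P_sum; apply: eq_bigr => j _; exact: graph_coord_mul_star.
Qed.

End SphereToGraph.

Definition sphere_iso_spec (K : numClosedFieldType) (n : nat)
    (A : unitalStarAlgType K) (z : 'I_n.+1 -> A) (L : starAlgType K)
    (P : vertex (Sigma n) -> L) (S : edge (Sigma n) -> L)
    (phi : L -> A) (phi_inv : A -> L) : Prop :=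
  [/\ star_hom phi, star_hom phi_inv, phi_inv aone = \sum_v P v,
      cancel phi phi_inv & cancel phi_inv phi] /\
  [/\ forall i, phi (P i) = z i ** star (z i),
      forall e, phi (S e) = z (src e) ** z (tgt e) ** star (z (tgt e))
    & forall i : 'I_n.+1,
        phi_inv (z i) = \sum_(e : edge (Sigma n) | src e == i) S e].

Section GraphSphereIso.
Variables (K : numClosedFieldType) (n : nat).
Variables (A : unitalStarAlgType K) (z : 'I_n.+1 -> A).
Hypothesis A_sphere : sphere_algebra z.

Lemma unital_leavitt_sphere_iso (L : unitalStarAlgType K)
    (P : vertex (Sigma n) -> L) (S : edge (Sigma n) -> L) :
  leavitt_algebra P S -> \sum_v P v = aone ->
  exists (phi : L -> A) (phi_inv : A -> L), sphere_iso_spec z P S phi phi_inv.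
Proof.
move=> L_leavitt sumP.
have [z_rel univA] := A_sphere; have [rel starP univL] := L_leavitt.
have [phi [[hphi phiP phiS phiSd] _]] := univL _ _ _ _ (sphere_leavitt z_rel).
have [psi [[hpsi psiz] _]] := univA L _ (graph_sphere rel sumP).
have phi_hom : star_hom phi.
  split=> // x; rewrite -{2}(starK x); move: (star x) => {}x.
  apply: (leavitt_hom_ext L_leavitt hphi (alg_hom_star_conj hphi)).
  - by move=> v; rewrite starP phiP star_range_proj.
  - by move=> e; rewrite phiSd phiS starK.
  - by move=> e; rewrite starK phiS phiSd.
have [[lpsi mpsi] spsi] := hpsi.1.
have coordP := graph_coord_mul_star rel.
have psiS e : psi (phi (S e)) = S e.
  rewrite phiS /sphere_edge -amulA !mpsi spsi !psiz coordP.
  rewrite (graph_coord_proj rel (Sigma_edge_le e)); congr S.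
  by apply/eqP; rewrite Sigma_edge_eq !eqxx.
exists phi, psi; split; last by split.
split=> //; first by rewrite hpsi.2.
- apply: (leavitt_hom_ext L_leavitt (f := psi \o phi) (g := id)) => //.
  + exact: alg_hom_comp hphi hpsi.1.1.
  + by move=> v /=; rewrite phiP /sphere_vertex mpsi spsi psiz coordP.
  + by move=> e /=; rewrite phi_hom.2 spsi psiS.
- apply: (sphere_hom_ext A_sphere (f := phi \o psi) (g := id)) => //.
    apply: unital_star_hom_comp hpsi _; split=> //.
    rewrite -sumP (lin_sum hphi.1); have [_ _ _ <-] := z_rel.
    by apply: eq_bigr => v _; exact: phiP.
  move=> i /=; rewrite psiz /graph_coord (lin_sum hphi.1).
  under eq_bigr => e /eqP ei do rewrite phiS /sphere_edge ei -amulA.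
  rewrite (Sigma_sum_from i (fun j => z i ** (z j ** star (z j)))).
  by rewrite -amul_sumr; have [_ _ <- _] := z_rel; exact: sphere_source_proj.
Qed.

Lemma leavitt_sphere_iso (L : starAlgType K)
    (P : vertex (Sigma n) -> L) (S : edge (Sigma n) -> L) :
  leavitt_algebra P S ->
  exists (phi : L -> A) (phi_inv : A -> L), sphere_iso_spec z P S phi phi_inv.
Proof.
move=> L_leavitt; have e_unit := leavitt_unit L_leavitt.
pose L1 : unitalStarAlgType K := HB.pack L (AssocAlgebra_hasOne.Build K L
  (fun x => (e_unit x).1) (fun x => (e_unit x).2)).
exact: (@unital_leavitt_sphere_iso L1 P S L_leavitt erefl).
Qed.

(** The gauge action and its transport through [phi] are morphisms with the
    same values on the generators. *)
Lemma sphere_iso_equivariant (L : starAlgType K) (P : vertex (Sigma n) -> L)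
    (S : edge (Sigma n) -> L) (phi : L -> A) (phi_inv : A -> L)
    (gamma : L -> L) (alpha : A -> A) (u : K) :
  leavitt_algebra P S -> sphere_iso_spec z P S phi phi_inv -> `|u| = 1 ->
  star_hom gamma -> (forall v, gamma (P v) = P v) ->
  (forall e, gamma (S e) = u *: S e) ->
  star_hom alpha -> (forall i, alpha (z i) = u *: z i) ->
  forall x, phi (gamma x) = alpha (phi x).
Proof.
move=> L_leavitt [[hphi _ _ _ _] [phiP phiS _]] u1 hg gP gS ha az.
have uu : u * u^* = 1 by rewrite -normCK u1 expr1n.
have [[lphi mphi] sphi] := hphi; have [[la ma] sa] := ha.
have aS e : phi (gamma (S e)) = alpha (phi (S e)).
  rewrite gS (linZ lphi) phiS -amulA !ma sa !az starZ.
  by rewrite !(amulZl, amulZr, scalerA) -mulrA uu mulr1 amulA.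
apply: (leavitt_hom_ext L_leavitt (f := phi \o gamma) (g := alpha \o phi)).
- exact: alg_hom_comp hg.1 hphi.1.
- exact: alg_hom_comp hphi.1 ha.1.
- move=> v /=; rewrite gP phiP ma sa az starZ.
  by rewrite amulZl amulZr scalerA uu scale1r.
- exact: aS.
- by move=> e /=; rewrite hg.2 !sphi sa aS.
Qed.

(** Both completions are determined by universal properties, and [phi] exchanges
    these once the graph C*-algebra is known to have a unit. *)
Lemma graph_envelope_iso (L : starAlgType K) (P : vertex (Sigma n) -> L)
    (S : edge (Sigma n) -> L) (phi : L -> A) (phi_inv : A -> L)
    (C : unitalCStarAlgType K) (iota : A -> C)
    (G : cstarAlgType K) (PG : vertex (Sigma n) -> G)
    (SG : edge (Sigma n) -> G) (kappa : L -> G) :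
  leavitt_algebra P S -> sphere_iso_spec z P S phi phi_inv ->
  cstar_envelope iota -> graph_cstar_algebra PG SG -> star_hom kappa ->
  (forall v, kappa (P v) = PG v) -> (forall e, kappa (S e) = SG e) ->
  exists phit : G -> C,
    star_hom phit /\ bijective phit /\ forall x, phit (kappa x) = iota (phi x).
Proof.
move=> L_leavitt [[hphi hphi' phi'1 phiK phi'K] _] C_env G_graph hk kP kS.
have [rel starP _] := L_leavitt.
have [[hi _] univC] := C_env; have [_ univG] := G_graph.
have relG : leavitt_relations PG SG (fun e => star (SG e)).
  have := leavitt_relations_hom hk.1 rel.
  have -> : kappa \o P = PG by apply/funext => v; exact: kP.
  have -> : kappa \o S = SG by apply/funext => e; exact: kS.
  have -> // : kappa \o (fun e => star (S e)) = (fun e => star (SG e)).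
  by apply/funext => e /=; rewrite hk.2 kS.
have g_unit := graph_unit G_graph relG.
pose G1 : unitalCStarAlgType K := HB.pack G (AssocAlgebra_hasOne.Build K G
  (fun x => (g_unit x).1) (fun x => (g_unit x).2)).
have hik : star_hom (iota \o phi) := star_hom_comp hphi hi.
have relC := leavitt_relations_hom hik.1 rel.
have ckC : cuntz_krieger_family (iota \o phi \o P) (iota \o phi \o S).
  apply: cuntz_krieger_of_leavitt.
    suff -> : (fun e => star ((iota \o phi \o S) e)) =
              (iota \o phi) \o (fun e => star (S e)) by [].
    by apply/funext => e /=; rewrite hphi.2 hi.2.
  by move=> v /=; rewrite -hi.2 -hphi.2 starP.
have [phit [[hphit phitP phitS] _]] := univG _ _ _ ckC.
have phit_kappa x : phit (kappa x) = iota (phi x).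
  apply: (leavitt_hom_ext L_leavitt (f := phit \o kappa) (g := iota \o phi)).
  - exact: alg_hom_comp hk.1 hphit.1.
  - exact: hik.1.
  - by move=> v /=; rewrite kP phitP.
  - by move=> e /=; rewrite kS phitS.
  - by move=> e /=; rewrite hk.2 hphit.2 kS phitS /= hphi.2 hi.2.
have hj : unital_star_hom (kappa \o phi_inv : A -> G1).
  split; first exact: star_hom_comp hphi' hk.
  rewrite /= phi'1 (lin_sum hk.1.1); by apply: eq_bigr.
have [psi [[hpsi psi_iota] _]] := univC G1 _ hj.
exists phit; split=> //; split=> //.
exists (psi : C -> G).
- apply: (graph_hom_ext G_graph (f := (psi : C -> G) \o phit) (g := id)).
  + exact: star_hom_comp hphit hpsi.1.
  + exact: star_hom_id.
  + by move=> v /=; rewrite phitP /= psi_iota /= phiK kP.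
  + by move=> e /=; rewrite phitS /= psi_iota /= phiK kS.
- apply: (envelope_hom_ext C_env (f := phit \o (psi : C -> G)) (g := id)).
  + split; first exact: star_hom_comp hpsi.1 hphit.
    rewrite /= hpsi.2 -[aone]/(\sum_v PG v) (lin_sum hphit.1.1).
    rewrite -[RHS](C_env.1.2) -[aone in RHS]phi'K phi'1.
    rewrite !(lin_sum hphi.1.1, lin_sum hi.1.1).
    by apply: eq_bigr => v _; exact: phitP.
  + exact: unital_star_hom_id.
  + by move=> a /=; rewrite psi_iota /= phit_kappa phi'K.
Qed.

End GraphSphereIso.

(** * Subalgebras *)

Record subalg (K : numClosedFieldType) (A : unitalStarAlgType K) := Subalg {
  subalg_mem :> A -> Prop;
  subalg1 : subalg_mem aone;
  subalg_lin : forall (c : K) x y,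
    subalg_mem x -> subalg_mem y -> subalg_mem (c *: x + y);
  subalgM : forall x y, subalg_mem x -> subalg_mem y -> subalg_mem (x ** y);
  subalg_star : forall x, subalg_mem x -> subalg_mem (star x)
}.

Section SubalgType.
Variables (K : numClosedFieldType) (A : unitalStarAlgType K) (Q : subalg A).

Definition subalg_pred : {pred A} := [pred x | `[< Q x >]].

Lemma subalg_predP x : reflect (Q x) (x \in subalg_pred).
Proof. exact: asboolP. Qed.

Lemma subalg_submod_closed : submod_closed subalg_pred.
Proof.
split; last first.
  by move=> c x y /subalg_predP Qx /subalg_predP Qy; apply/subalg_predP/subalg_lin.
apply/subalg_predP; rewrite -[0](addNr (aone : A)) -scaleN1r.
by apply: subalg_lin; exact: subalg1.
Qed.

HB.instance Definition _ :=
  GRing.isSubmodClosed.Build K A subalg_pred subalg_submod_closed.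

Record subalg_type := SubalgType {
  subalg_val :> A; _ : subalg_val \in subalg_pred }.
HB.instance Definition _ := [isSub for subalg_val].
HB.instance Definition _ := [Choice of subalg_type by <:].
HB.instance Definition _ := [SubChoice_isSubLmodule of subalg_type by <:].

Lemma subalg_valP (x : subalg_type) : Q (val x).
Proof. exact/subalg_predP/valP. Qed.

Definition subalg_make x (Qx : Q x) : subalg_type :=
  SubalgType (introT (subalg_predP x) Qx).

Definition subalg_mul (x y : subalg_type) : subalg_type :=
  subalg_make (subalgM (subalg_valP x) (subalg_valP y)).

Definition subalg_adj (x : subalg_type) : subalg_type :=
  subalg_make (subalg_star (subalg_valP x)).

Definition subalg_one : subalg_type := subalg_make (subalg1 Q).

Fact subalg_mulA : associative subalg_mul.
Proof. by move=> x y z; apply/val_inj/amulA. Qed.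

Fact subalg_mulDl : left_distributive subalg_mul +%R.
Proof. by move=> x y z; apply/val_inj/amulDl. Qed.

Fact subalg_mulDr : right_distributive subalg_mul +%R.
Proof. by move=> x y z; apply/val_inj/amulDr. Qed.

Fact subalg_mulZl (a : K) x y : subalg_mul (a *: x) y = a *: subalg_mul x y.
Proof. by apply/val_inj/amulZl. Qed.

Fact subalg_mulZr (a : K) x y : subalg_mul x (a *: y) = a *: subalg_mul x y.
Proof. by apply/val_inj/amulZr. Qed.

HB.instance Definition _ := Lmodule_hasAlgMul.Build K subalg_type
  subalg_mulA subalg_mulDl subalg_mulDr subalg_mulZl subalg_mulZr.

Fact subalg_adjK : involutive subalg_adj.
Proof. by move=> x; apply/val_inj/starK. Qed.

Fact subalg_adjD : {morph subalg_adj : x y / x + y}.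
Proof. by move=> x y; apply/val_inj/starD. Qed.

Fact subalg_adjZ (a : K) x : subalg_adj (a *: x) = a^* *: subalg_adj x.
Proof. by apply/val_inj/starZ. Qed.

Fact subalg_adjM (x y : subalg_type) :
  subalg_adj (x ** y) = subalg_adj y ** subalg_adj x.
Proof. by apply/val_inj/starM. Qed.

HB.instance Definition _ := AssocAlgebra_hasStar.Build K subalg_type
  subalg_adjK subalg_adjD subalg_adjZ subalg_adjM.

Fact subalg_mul1l : left_id subalg_one amul.
Proof. by move=> x; apply/val_inj/amul1l. Qed.

Fact subalg_mul1r : right_id subalg_one amul.
Proof. by move=> x; apply/val_inj/amul1r. Qed.

HB.instance Definition _ := AssocAlgebra_hasOne.Build K subalg_type
  subalg_mul1l subalg_mul1r.

Lemma subalg_val_hom : unital_star_hom (subalg_val : subalg_type -> A).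
Proof. by []. Qed.

Lemma subalg_corestrict (D : unitalStarAlgType K) (f : D -> A)
    (Qf : forall x, Q (f x)) :
  unital_star_hom f -> unital_star_hom (fun x => subalg_make (Qf x)).
Proof.
move=> [[[lf mf] sf] f1]; split; [split; [split|]|].
- by move=> c x y; apply/val_inj/lf.
- by move=> x y; apply/val_inj/mf.
- by move=> x; apply/val_inj/sf.
- exact/val_inj.
Qed.

End SubalgType.

(** The generators generate: the subalgebra receives a morphism from the sphere
    algebra, which followed by the inclusion must be the identity. *)
Lemma sphere_ind (K : numClosedFieldType) (n : nat) (A : unitalStarAlgType K)
    (z : 'I_n.+1 -> A) (Q : subalg A) :
  sphere_algebra z -> (forall i, Q (z i)) -> forall x, Q x.
Proof.
move=> A_sphere Qz x; have [z_rel univ] := A_sphere.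
pose y i : subalg_type Q := subalg_make (Qz i).
have y_rel : sphere_relations y.
  have [r1 r2 r3 r4] := z_rel; split.
  - by move=> i j ij; apply/val_inj/r1.
  - by move=> i j ij; apply/val_inj/r2.
  - move=> i; apply/val_inj => /=; rewrite r3.
    by rewrite (lin_sum (subalg_val_hom Q).1.1.1).
  - by apply/val_inj; rewrite /= -r4 (lin_sum (subalg_val_hom Q).1.1.1).
have [f [[hf fz] _]] := univ _ _ y_rel.
have <- : subalg_val (f x) = x; last exact: subalg_valP.
apply: (sphere_hom_ext A_sphere (f := (@subalg_val _ _ Q) \o f) (g := id)).
- exact: unital_star_hom_comp hf (subalg_val_hom Q).
- exact: unital_star_hom_id.
- by move=> i /=; rewrite fz.
Qed.

Section ClosedSubalg.
Variables (K : numClosedFieldType) (B : unitalCStarAlgType K).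

Record closed_subalg := ClosedSubalg {
  closed_subalg_subalg :> subalg B;
  closed_subalg_closed : closed [set x | closed_subalg_subalg x]
}.

Variable Q : closed_subalg.

Definition closed_subalg_type : Type := subalg_type Q.
HB.instance Definition _ := UnitalStarAlgebra.on closed_subalg_type.

Implicit Types x y : closed_subalg_type.

Definition csub_norm x : K := `|val x|.

Fact csub_normD x y : csub_norm (x + y) <= csub_norm x + csub_norm y.
Proof. exact: ler_normD. Qed.

Fact csub_normZ (c : K) x : csub_norm (c *: x) = `|c| * csub_norm x.
Proof. exact: normrZ. Qed.

Fact csub_norm0 x : csub_norm x = 0 -> x = 0.
Proof. by move=> /normr0_eq0 x0; exact/val_inj. Qed.

HB.instance Definition _ := Lmodule_isNormed.Build K closed_subalg_type
  csub_normD csub_normZ csub_norm0.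

Fact csub_complete (F : set_system closed_subalg_type) :
  ProperFilter F -> cauchy F -> cvg F.
Proof.
move=> FF /cauchyP Fc.
pose v : closed_subalg_type -> B := @subalg_val _ _ Q.
have vF : cvg (v @ F).
  apply: cauchy_cvg; apply/cauchyP => e e0.
  have [x Fx] := Fc e e0; exists (v x).
  suff : F (v @^-1` ball (v x) e) by [].
  apply: filterS Fx => y; rewrite -ball_normE /= => xy.
  by rewrite -ball_normE.
have Ql : Q (lim (v @ F)).
  apply: (closed_cvg (F := F) (u_ := v) _ _ _ _ vF).
    exact: closed_subalg_closed.
  by apply: nearW => x; exact: subalg_valP.
apply/cvg_ex; exists (subalg_make Ql : closed_subalg_type).
apply/cvgrPdist_lt => e e0; move/cvgrPdist_lt : vF => /(_ e e0).
by apply: filterS => x.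
Qed.

HB.instance Definition _ :=
  Uniform_isComplete.Build closed_subalg_type csub_complete.

Fact csub_norm_amul x y : `|x ** y| <= `|x| * `|y|.
Proof. exact: norm_amul. Qed.

Fact csub_norm_cstar x : `|star x ** x| = `|x| ^+ 2.
Proof. exact: norm_cstar. Qed.

HB.instance Definition _ := isCStarNorm.Build K closed_subalg_type
  csub_norm_amul csub_norm_cstar.

End ClosedSubalg.

(** * Direct sums of C*-algebras *)

Section DirectSum.
Variables (K : numClosedFieldType) (B D : unitalCStarAlgType K).

Definition dsum : Type := (B * D)%type.
HB.instance Definition _ := NormedModule.on dsum.

Implicit Types x y : dsum.

Fact dsum_complete (F : set_system dsum) :
  ProperFilter F -> cauchy F -> cvg F.
Proof.
move=> FF /cauchyP Fc.
have F1 : cvg (fst @ F : set_system B).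
  apply: cauchy_cvg; apply/cauchyP => e e0.
  have [x Fx] := Fc e e0; exists x.1.
  suff : F (fst @^-1` ball x.1 e) by [].
  by apply: filterS Fx => y [].
have F2 : cvg (snd @ F : set_system D).
  apply: cauchy_cvg; apply/cauchyP => e e0.
  have [x Fx] := Fc e e0; exists x.2.
  suff : F (snd @^-1` ball x.2 e) by [].
  by apply: filterS Fx => y [].
apply/cvg_ex; exists (lim (fst @ F : set_system B), lim (snd @ F : set_system D)).
move=> U [[U1 U2] [/F1 FU1 /F2 FU2] U12].
have FU : F ((fst @^-1` U1) `&` (snd @^-1` U2)).
  by apply: filterI; [exact: FU1|exact: FU2].
by apply: filterS FU => y U12y; exact: (U12 y).
Qed.

HB.instance Definition _ := Uniform_isComplete.Build dsum dsum_complete.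

Definition dsum_mul x y : dsum := (x.1 ** y.1, x.2 ** y.2).
Definition dsum_adj x : dsum := (star x.1, star x.2).
Definition dsum_one : dsum := (aone, aone).

Fact dsum_mulA : associative dsum_mul.
Proof. by move=> x y z; congr pair; exact: amulA. Qed.

Fact dsum_mulDl : left_distributive dsum_mul +%R.
Proof. by move=> x y z; congr pair; exact: amulDl. Qed.

Fact dsum_mulDr : right_distributive dsum_mul +%R.
Proof. by move=> x y z; congr pair; exact: amulDr. Qed.

Fact dsum_mulZl (a : K) x y : dsum_mul (a *: x) y = a *: dsum_mul x y.
Proof. by congr pair; exact: amulZl. Qed.

Fact dsum_mulZr (a : K) x y : dsum_mul x (a *: y) = a *: dsum_mul x y.
Proof. by congr pair; exact: amulZr. Qed.

HB.instance Definition _ := Lmodule_hasAlgMul.Build K dsum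
  dsum_mulA dsum_mulDl dsum_mulDr dsum_mulZl dsum_mulZr.

Fact dsum_adjK : involutive dsum_adj.
Proof. by move=> [x1 x2]; congr pair; exact: starK. Qed.

Fact dsum_adjD : {morph dsum_adj : x y / x + y}.
Proof. by move=> x y; congr pair; exact: starD. Qed.

Fact dsum_adjZ (a : K) x : dsum_adj (a *: x) = a^* *: dsum_adj x.
Proof. by congr pair; exact: starZ. Qed.

Fact dsum_adjM x y : dsum_adj (x ** y) = dsum_adj y ** dsum_adj x.
Proof. by congr pair; exact: starM. Qed.

HB.instance Definition _ := AssocAlgebra_hasStar.Build K dsum
  dsum_adjK dsum_adjD dsum_adjZ dsum_adjM.

Fact dsum_mul1l : left_id dsum_one amul.
Proof. by move=> [x1 x2]; congr pair; exact: amul1l. Qed.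

Fact dsum_mul1r : right_id dsum_one amul.
Proof. by move=> [x1 x2]; congr pair; exact: amul1r. Qed.

HB.instance Definition _ := AssocAlgebra_hasOne.Build K dsum
  dsum_mul1l dsum_mul1r.

Lemma dsum_normE x : `|x| = Num.max `|x.1| `|x.2|.
Proof. exact: prod_normE. Qed.

Lemma dsum_norm_le x a : (`|x| <= a) = (`|x.1| <= a) && (`|x.2| <= a).
Proof.
by rewrite dsum_normE comparable_ge_max // real_comparable // normr_real.
Qed.

Fact dsum_norm_amul x y : `|x ** y| <= `|x| * `|y|.
Proof.
have := lexx `|x|; have := lexx `|y|; rewrite !{1}dsum_norm_le.
move=> /andP[y1 y2] /andP[x1 x2]; apply/andP; split.
  by apply: le_trans (norm_amul _ _) _; exact: ler_pM.
by apply: le_trans (norm_amul _ _) _; exact: ler_pM.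
Qed.

Fact dsum_norm_cstar x : `|star x ** x| = `|x| ^+ 2.
Proof.
rewrite !dsum_normE /= !norm_cstar.
have : `|x.1| >=< `|x.2| by rewrite real_comparable // normr_real.
case/comparable_leP => [le12|lt12].
  by rewrite max_r // ler_pXn2r ?nnegrE.
by rewrite max_l // ler_pXn2r ?nnegrE // ltW.
Qed.

HB.instance Definition _ := isCStarNorm.Build K dsum
  dsum_norm_amul dsum_norm_cstar.

End DirectSum.

(** * The sphere generators as a tower of isometries *)

Lemma sum2_delta (V : nmodType) (d p q : nat) (F : nat -> nat -> V) :
  (p <= d)%N -> (q <= d)%N ->
  \sum_(a < d.+1) \sum_(b < d.+1) (if (a == p :> nat) && (b == q :> nat)
    then F a b else 0) = F p q.
Proof.
move=> pd qd; rewrite (bigD1 (Ordinal (pd : p < d.+1)%N)) //=.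
rewrite (bigD1 (Ordinal (qd : q < d.+1)%N)) //= !eqxx /= !big1 ?addr0 //.
  by move=> a; rewrite -val_eqE /= => /negbTE ap; apply: big1 => b _; rewrite ap.
by move=> b; rewrite -val_eqE /= => /negbTE ->.
Qed.


Definition apow (K : numClosedFieldType) (A : unitalStarAlgType K) (x : A)
  (k : nat) : A := iter k (amul x) aone.

Section Powers.
Variables (K : numClosedFieldType) (A : unitalStarAlgType K).
Implicit Types x y : A.

Lemma apow0 x : apow x 0 = aone. Proof. by []. Qed.

Lemma apowS x k : apow x k.+1 = x ** apow x k. Proof. by []. Qed.

Lemma apowSr x k : apow x k.+1 = apow x k ** x.
Proof.
elim: k => [|k IH]; first by rewrite apowS apow0 amul1l amul1r.
by rewrite apowS {1}IH amulA.
Qed.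

Lemma star_apow x k : star (apow x k) = apow (star x) k.
Proof.
by elim: k => [|k IH]; [rewrite star1 | rewrite apowS apowSr starM IH].
Qed.

End Powers.

(** The generators are indexed by all natural numbers, the ones of index above
    [n] being zero, so that the third sphere relation becomes the uniform
    recursion [w_i^* w_i = w_i w_i^* + w_(i+1)^* w_(i+1)]. *)
Record tower_relations (K : numClosedFieldType) (n : nat)
    (A : unitalStarAlgType K) (w : nat -> A) : Prop := TowerRelations {
  tower_mul0 : forall i j, (j < i)%N -> w i ** w j = 0;
  tower_star_mul0 : forall i j, i != j -> star (w i) ** w j = 0;
  tower_rec : forall i, star (w i) ** w i =
    w i ** star (w i) + star (w i.+1) ** w i.+1;
  tower_unit : star (w 0) ** w 0 = aone;
  tower_top : forall i, (n < i)%N -> w i = 0;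
  tower_source : forall i, w i ** (star (w i) ** w i) = w i
}.

Section SphereTower.
Variables (K : numClosedFieldType) (n : nat) (A : unitalStarAlgType K).
Variable z : 'I_n.+1 -> A.

Definition ztower (i : nat) : A := oapp z 0 (insub i : option 'I_n.+1).

Lemma ztowerE (i : 'I_n.+1) : ztower i = z i.
Proof. by rewrite /ztower valK. Qed.

Lemma ztower_ord i (lt_in : (i < n.+1)%N) : ztower i = z (Ordinal lt_in).
Proof. by rewrite -ztowerE. Qed.

Lemma ztower_out i : (n < i)%N -> ztower i = 0.
Proof. by move=> ni; rewrite /ztower insubN // -leqNgt. Qed.

Lemma sphere_tower : sphere_relations z -> tower_relations n ztower.
Proof.
move=> z_rel; have [zz zsz zszE zsum] := z_rel.
have sourceE i : star (ztower i) ** ztower i =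
    \sum_(i <= j < n.+1) ztower j ** star (ztower j).
  case: (ltnP i n.+1) => [lt_in|lt_ni]; last first.
    by rewrite ztower_out // amul0r big_geq.
  rewrite (ztower_ord lt_in) zszE big_geq_mkord /=.
  by apply: eq_bigr => j _; rewrite ztowerE.
split.
- move=> i j ji; case: (ltnP i n.+1) => [lt_in|/ztower_out ->]; last exact: amul0l.
  rewrite (ztower_ord lt_in) (ztower_ord (ltn_trans ji lt_in)); exact: zz.
- move=> i j ij; case: (ltnP i n.+1) => [lt_in|/ztower_out ->]; last first.
    by rewrite star0 amul0l.
  case: (ltnP j n.+1) => [lt_jn|/ztower_out ->]; last exact: amul0r.
  by rewrite (ztower_ord lt_in) (ztower_ord lt_jn); apply: zsz.
- move=> i; rewrite !sourceE; case: (ltnP i n.+1) => [lt_in|lt_ni].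
    by rewrite big_ltn.
  by rewrite ztower_out // amul0l add0r !big_geq // ltnW.
- rewrite sourceE big_mkord -zsum.
  by apply: eq_bigr => j _; rewrite ztowerE.
- exact: ztower_out.
- move=> i; case: (ltnP i n.+1) => [lt_in|/ztower_out ->]; last exact: amul0l.
  by rewrite (ztower_ord lt_in) sphere_source_proj.
Qed.

End SphereTower.

Section Tower.
Variables (K : numClosedFieldType) (n : nat) (A : unitalStarAlgType K).
Variable w : nat -> A.
Hypothesis w_rel : tower_relations n w.
Implicit Types (i j d p q : nat) (x y : A).

Definition tsource i := star (w i) ** w i.
Local Notation src_ := tsource.

Let ww := tower_mul0 w_rel.
Let wsw := tower_star_mul0 w_rel.

Lemma star_tsource i : star (src_ i) = src_ i.
Proof. by rewrite starM starK. Qed.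

Lemma range_tsource i : w i ** star (w i) = src_ i - src_ i.+1.
Proof. by rewrite /src_ (tower_rec w_rel i) addrK. Qed.

Lemma tsource_gt_mul i j : (i < j)%N -> src_ j ** w i = 0.
Proof. by move=> ij; rewrite -amulA ww // amul0r. Qed.

Lemma tsource_mul i j : (i <= j)%N -> src_ i ** w j = w j.
Proof.
move=> ij; rewrite -(subnKC ij); move: (j - i)%N => k {ij}; elim: k i => [|k IH] i.
  rewrite addn0 /src_ (tower_rec w_rel) amulDl -/(src_ i.+1).
  by rewrite tsource_gt_mul // addr0 -amulA (tower_source w_rel).
rewrite /src_ (tower_rec w_rel) amulDl -/(src_ i.+1) -addSnnS IH -amulA.
by rewrite wsw ?amul0r ?add0r // addSn; lia.
Qed.

Lemma mul_tsource i j : (i <= j)%N -> w j ** src_ i = w j.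
Proof.
move=> ij; rewrite -(subnKC ij); move: (j - i)%N => k {ij}; elim: k i => [|k IH] i.
  by rewrite addn0 (tower_source w_rel).
rewrite /src_ (tower_rec w_rel) amulDr -/(src_ i.+1) -addSnnS IH amulA.
by rewrite ww ?amul0l ?add0r // addSn; lia.
Qed.

Lemma star_mul_tsource i j : (i <= j)%N -> star (w j) ** src_ i = star (w j).
Proof. by move=> ij; rewrite -{2}(tsource_mul ij) starM star_tsource. Qed.

Lemma tsource_mul_star i j : (i <= j)%N -> src_ i ** star (w j) = star (w j).
Proof. by move=> ij; rewrite -{2}(mul_tsource ij) starM star_tsource. Qed.

Lemma star_mul_tsource_gt i j : (i < j)%N -> star (w i) ** src_ j = 0.
Proof.
by move=> ij; rewrite -(star_tsource j) -starM tsource_gt_mul // star0.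
Qed.

Lemma tsourceM i j : (i <= j)%N -> src_ i ** src_ j = src_ j.
Proof. by move=> ij; rewrite {2}/src_ amulA tsource_mul_star. Qed.

(** The corner [z_i^p Y (z_i^* )^q]: for [Y] below the projection number [i+1]
    these are the matrix units of the Toeplitz algebra at level [i], with
    coefficients in the next level. *)
Definition conjug i p q (Y : A) : A := apow (w i) p ** Y ** apow (star (w i)) q.

Lemma conjug_lin i p q c x y :
  conjug i p q (c *: x + y) = c *: conjug i p q x + conjug i p q y.
Proof. by rewrite /conjug amulDr amulDl amulZr amulZl. Qed.

Lemma conjugB i p q x y :
  conjug i p q (x - y) = conjug i p q x - conjug i p q y.
Proof. by rewrite addrC -scaleN1r conjug_lin scaleN1r addrC. Qed.

Lemma conjug0 i p q : conjug i p q 0 = 0.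
Proof. by rewrite /conjug amul0r amul0l. Qed.

Lemma star_conjug i p q x : star (conjug i p q x) = conjug i q p (star x).
Proof. by rewrite /conjug !starM !star_apow starK amulA. Qed.

Lemma mul_conjug i p q x : w i ** conjug i p q x = conjug i p.+1 q x.
Proof. by rewrite /conjug apowS !amulA. Qed.

Lemma conjug0l i q x : conjug i 0 q x = x ** apow (star (w i)) q.
Proof. by rewrite /conjug apow0 amul1l. Qed.

Lemma conjug00 i x : conjug i 0 0 x = x.
Proof. by rewrite conjug0l apow0 amul1r. Qed.

Lemma mul_conjug_kill i p q x y :
  x ** w i = 0 -> x ** conjug i p.+1 q y = 0.
Proof. by move=> x0; rewrite -mul_conjug amulA x0 amul0l. Qed.

Lemma mul_conjug0l i q x y : x ** conjug i 0 q y = conjug i 0 q (x ** y).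
Proof. by rewrite !conjug0l amulA. Qed.

Lemma tsource_conjug i p q x : src_ i ** x = x ->
  src_ i ** conjug i p q x = conjug i p q x.
Proof.
move=> ix; case: p => [|p]; first by rewrite mul_conjug0l ix.
by rewrite -mul_conjug amulA tsource_mul.
Qed.

Lemma star_mul_conjug i p q x : src_ i ** x = x ->
  star (w i) ** conjug i p.+1 q x = conjug i p q x.
Proof. by move=> ix; rewrite -mul_conjug amulA -/(src_ i) tsource_conjug. Qed.

(** * A normal form in the sphere algebra *)

(** Elements of the corner of level [i] and degree at most [d]. A word either
    continues to the next level, or ends in a Laurent monomial in [z_i]; the
    Toeplitz words [z_i^p z_i^*q] with [p] and [q] both positive are left out
    since [z_i z_i^*] differs from the unit of the corner by the unit of the
    next one, and with them the representation below would not be unique. *)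
Inductive tspan : nat -> nat -> A -> Prop :=
| tspan0 i d : tspan i d 0
| tspan_lin i d c x y :
    tspan i d x -> tspan i d y -> tspan i d (c *: x + y)
| tspan_laurent i d p q : (p <= d)%N -> (q <= d)%N -> (p == 0%N) || (q == 0%N) ->
    tspan i d (conjug i p q (src_ i))
| tspan_conjug i d p q Y : (p <= d)%N -> (q <= d)%N -> tspan i.+1 d Y ->
    tspan i d (conjug i p q Y).

Lemma tspanB i d x y : tspan i d x -> tspan i d y -> tspan i d (x - y).
Proof.
by move=> hx hy; rewrite addrC -scaleN1r; exact: tspan_lin.
Qed.

Lemma tspan_le i d e x : (d <= e)%N -> tspan i d x -> tspan i e x.
Proof.
move=> de hx; elim: hx e de => {i d x}.
- by move=> i d e _; exact: tspan0.
- by move=> i d c x y _ IHx _ IHy e de; apply: tspan_lin; [exact: IHx|exact: IHy].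
- move=> i d p q pd qd pq e de; apply: tspan_laurent => //; exact: leq_trans de.
- move=> i d p q Y pd qd _ IH e de.
  by apply: tspan_conjug; [exact: leq_trans de|exact: leq_trans de|exact: IH].
Qed.

Lemma tspan_star i d x : tspan i d x -> tspan i d (star x).
Proof.
elim=> {i d x}.
- by move=> i d; rewrite star0; exact: tspan0.
- by move=> i d c x y _ hx _ hy; rewrite starD starZ; exact: tspan_lin.
- move=> i d p q pd qd pq; rewrite star_conjug star_tsource.
  by apply: tspan_laurent => //; rewrite orbC.
- by move=> i d p q Y pd qd _ IH; rewrite star_conjug; exact: tspan_conjug.
Qed.

Lemma tsource_tspan i d x : tspan i d x -> src_ i ** x = x.
Proof.
elim=> {i d x}.
- by move=> i d; rewrite amul0r.
- by move=> i d c x y _ hx _ hy; rewrite amulDr amulZr hx hy.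
- by move=> i d p q _ _ _; rewrite tsource_conjug // tsourceM.
- move=> i d p q Y _ _ _ IH; rewrite tsource_conjug //.
  by rewrite -IH amulA tsourceM.
Qed.

Lemma tspan_tsource i d x : tspan i d x -> x ** src_ i = x.
Proof.
move=> /tspan_star /tsource_tspan /(congr1 star).
by rewrite starM star_tsource starK.
Qed.

Lemma tspan_top i d x : tspan i d x -> (n < i)%N -> x = 0.
Proof.
elim=> {i d x} //.
- by move=> i d c x y _ hx _ hy ni; rewrite hx // hy // scaler0 addr0.
- move=> i d p q _ _ _ ni.
  by rewrite /src_ (tower_top w_rel) // amul0r conjug0.
- by move=> i d p q Y _ _ _ IH ni; rewrite IH ?conjug0 // ltnW.
Qed.

Lemma tspan_source i d : tspan i d (src_ i).
Proof. by rewrite -[src_ i](conjug00 i); exact: tspan_laurent. Qed.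

Lemma tspan_gen i j : (i <= j)%N -> tspan i 1 (w j).
Proof.
move=> ij; rewrite -(subnKC ij); move: (j - i)%N => k {ij}; elim: k i => [|k IH] i.
  rewrite addn0 -(mul_tsource (leqnn i)) -[src_ i](conjug00 i) mul_conjug.
  exact: tspan_laurent.
by rewrite -[w _](conjug00 i) -addSnnS; apply: tspan_conjug.
Qed.

(** The span is stable by left multiplication by the generators and their
    adjoints; as it contains the unit it will exhaust the algebra. *)
Lemma tspan_mul i d x : tspan i d x -> forall j, (i <= j)%N ->
  tspan i d.+1 (w j ** x) /\ tspan i d.+1 (star (w j) ** x).
Proof.
elim=> {i d x}.
- by move=> i d j ij; rewrite !amul0r; split; exact: tspan0.
- move=> i d c x y _ hx _ hy j ij; rewrite !amulDr !amulZr.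
  have [hx1 hx2] := hx j ij; have [hy1 hy2] := hy j ij.
  by split; exact: tspan_lin.
- move=> i d p q pd qd pq j; rewrite leq_eqVlt => /predU1P[<-|ij].
    split.
      case: q => [|q] in qd pq *.
        by rewrite mul_conjug; apply: tspan_laurent => //; rewrite orbT.
      case: p => [|p] // in pd pq *.
      have -> : w i ** conjug i 0 q.+1 (src_ i) =
          conjug i 0 q (src_ i) - conjug i 0 q (src_ i.+1).
        have -> : conjug i 0 q.+1 (src_ i) = conjug i 0 q (star (w i)).
          by rewrite !conjug0l apowS amulA tsource_mul_star.
        by rewrite mul_conjug0l range_tsource conjugB.
      apply: tspanB; first by apply: tspan_laurent => //; lia.
      by apply: tspan_conjug; [lia|lia|exact: tspan_source].
    case: p => [|p] in pd pq *.
      have -> : star (w i) ** conjug i 0 q (src_ i) = conjug i 0 q.+1 (src_ i).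
        rewrite !conjug0l amulA star_mul_tsource // apowS amulA.
        by rewrite tsource_mul_star.
      exact: tspan_laurent.
    rewrite star_mul_conjug ?tsourceM //.
    case: q => [|q] // in qd pq *.
    by apply: tspan_laurent; rewrite ?orbT //; lia.
  case: p => [|p] in pd pq *.
    rewrite !mul_conjug0l mul_tsource ?star_mul_tsource 1?ltnW //.
    have gen_j := tspan_gen ij.
    split; apply: tspan_conjug; rewrite ?leqW //; first exact: tspan_le gen_j.
    by apply: tspan_star; exact: tspan_le gen_j.
  rewrite !mul_conjug_kill ?ww ?wsw //; last by rewrite gtn_eqF.
  by split; exact: tspan0.
- move=> i d p q Y pd qd hY IH j; rewrite leq_eqVlt => /predU1P[<-|ij].
    have iY : src_ i ** Y = Y.
      by rewrite -(tsource_tspan hY) amulA tsourceM.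
    have hY' := tspan_le (leqnSn d) hY.
    split; first by rewrite mul_conjug; apply: tspan_conjug; rewrite // leqW.
    case: p => [|p] in pd *.
      rewrite mul_conjug0l -(tsource_tspan hY) amulA star_mul_tsource_gt //.
      by rewrite amul0l conjug0; exact: tspan0.
    by rewrite star_mul_conjug //; apply: tspan_conjug => //; lia.
  have [hY1 hY2] := IH j ij.
  case: p => [|p] in pd *.
    by rewrite !mul_conjug0l; split; apply: tspan_conjug; rewrite // leqW.
  rewrite !mul_conjug_kill ?ww ?wsw //; last by rewrite gtn_eqF.
  by split; exact: tspan0.
Qed.

Definition normal_form i d (c : nat -> nat -> K) (T : nat -> nat -> A) : A :=
  \sum_(p < d.+1) \sum_(q < d.+1) conjug i p q (c p q *: src_ i + T p q).

(** The condition that makes the coefficients of a normal form unique. *)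
Definition laurent_coeff (c : nat -> nat -> K) : Prop :=
  forall p q, (p != 0%N) && (q != 0%N) -> c p q = 0.

Lemma tspan_normal_form i d x : tspan i d x -> exists c T,
  [/\ laurent_coeff c, forall p q, tspan i.+1 d (T p q)
    & x = normal_form i d c T].
Proof.
elim=> {i d x}.
- move=> i d; exists (fun _ _ => 0), (fun _ _ => 0); split=> //.
    by move=> p q; exact: tspan0.
  rewrite /normal_form big1 // => p _; rewrite big1 // => q _.
  by rewrite scale0r addr0 conjug0.
- move=> i d c x y _ [cx [Tx [lx sx ->]]] _ [cy [Ty [ly sy ->]]].
  exists (fun p q => c * cx p q + cy p q), (fun p q => c *: Tx p q + Ty p q).
  split=> [p q pq|p q|]; first by rewrite lx // ly // mulr0 addr0.
    exact: tspan_lin.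
  rewrite /normal_form scaler_sumr -big_split /=; apply: eq_bigr => p _.
  rewrite scaler_sumr -big_split /=; apply: eq_bigr => q _.
  by rewrite -conjug_lin scalerDr addrACA scalerA -scalerDl.
- move=> i d p q pd qd pq.
  exists (fun a b => ((a == p) && (b == q))%:R), (fun _ _ => 0).
  split=> [a b ab|a b|]; last 2 first.
  + exact: tspan0.
  + rewrite -(sum2_delta (fun a b => conjug i a b (src_ i)) pd qd).
    apply: eq_bigr => a _; apply: eq_bigr => b _.
    by case: ifP => _; rewrite addr0 ?scale1r // scale0r conjug0.
  case: eqP => //= ap; case: eqP => // bq; move: ab.
  by rewrite ap bq; case/orP: pq => -> //; rewrite andbF.
- move=> i d p q Y pd qd hY _.
  exists (fun _ _ => 0), (fun a b => if (a == p) && (b == q) then Y else 0).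
  split=> // [a b|]; first by case: ifP => // _; exact: tspan0.
  rewrite -(sum2_delta (fun a b => conjug i a b Y) pd qd).
  apply: eq_bigr => a _; apply: eq_bigr => b _.
  by rewrite scale0r add0r; case: ifP => _ //; rewrite conjug0.
Qed.

End Tower.

(** * Comparison of norms up to a polynomial in the degree *)

Section CStarNorm.
Variables (K : numClosedFieldType) (B : cstarAlgType K).
Implicit Types x y : B.

Lemma cstar_norm_star x : `|star x| = `|x|.
Proof.
have le_star y : `|y| <= `|star y|.
  have [->|y0] := eqVneq y 0; first by rewrite star0.
  by rewrite -(ler_pM2r (x := `|y|)) ?normr_gt0 // -expr2 -norm_cstar norm_amul.
by apply/eqP; rewrite eq_le le_star -{2}(starK x) le_star.
Qed.

Lemma cstar_norm_idem x : star x ** x = x -> `|x| <= 1.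
Proof.
move=> xx; have [->|x0] := eqVneq x 0; first by rewrite normr0.
by rewrite -(ler_pM2r (x := `|x|)) ?normr_gt0 // -expr2 -norm_cstar xx mul1r.
Qed.

Lemma cstar_norm_partial_isometry x : x ** (star x ** x) = x -> `|x| <= 1.
Proof.
move=> xxx; rewrite -(ler_pXn2r (n := 2)) ?nnegrE // expr1n -norm_cstar.
by apply: cstar_norm_idem; rewrite starM starK -!amulA xxx.
Qed.

End CStarNorm.

Section CornerEntries.
Variables (K : numClosedFieldType) (n : nat) (A : unitalStarAlgType K).
Variable w : nat -> A.
Hypothesis w_rel : tower_relations n w.
Local Notation src_ := (tsource w).

(** Compression that reads off the entry [(a, b)] of level [i + 1]: the
    projection number [i + 1] is orthogonal to the range of [z_i]. *)
Definition corner_entry i a b (x : A) : A :=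
  src_ i.+1 ** (apow (star (w i)) a ** x ** apow (w i) b) ** src_ i.+1.

Lemma corner_entry_lin i a b : linear (corner_entry i a b).
Proof.
move=> c x y; rewrite /corner_entry amulDr amulZr amulDl amulZl amulDr amulZr.
by rewrite amulDl amulZl.
Qed.

(** A surplus of either power leaves a factor [z_i^*] or [z_i] next to the
    projection number [i + 1], which kills it. *)
Lemma shift_unit_left i a p Y : src_ i.+1 ** Y = Y ->
  src_ i.+1 ** (apow (star (w i)) a ** (apow (w i) p ** Y)) =
  if a == p then Y else 0.
Proof.
move=> sY; have iY : src_ i ** Y = Y by rewrite -sY amulA (tsourceM w_rel).
elim: a p => [|a IH] [|p].
- by rewrite !apow0 !amul1l.
- by rewrite apow0 amul1l apowS 2!amulA (tsource_gt_mul w_rel) // !amul0l.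
- rewrite apowSr apow0 amul1l -sY (amulA _ (src_ _)) -(amulA _ _ (src_ _)).
  by rewrite (star_mul_tsource_gt w_rel) // amul0r amul0l amul0r.
- rewrite eqSS -IH apowSr apowS -(amulA (apow (star (w i)) a)).
  rewrite -(amulA (w i)) (amulA (star (w i))) -/(src_ i).
  by have := tsource_conjug w_rel p 0 iY; rewrite /conjug apow0 amul1r => ->.
Qed.

Lemma corner_entry_conjug i a b p q Y :
  src_ i.+1 ** Y = Y -> Y ** src_ i.+1 = Y ->
  corner_entry i a b (conjug w i p q Y) = if (a == p) && (b == q) then Y else 0.
Proof.
move=> sY Ys; have starY : src_ i.+1 ** star Y = star Y.
  by rewrite -{2}Ys starM star_tsource.
have right : (Y ** apow (star (w i)) q ** apow (w i) b) ** src_ i.+1 =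
    if b == q then Y else 0.
  have := congr1 star (shift_unit_left b q starY).
  rewrite (fun_if star) star0 starK => <-.
  by rewrite starM star_tsource !starM !star_apow !starK amulA.
have -> : corner_entry i a b (conjug w i p q Y) = src_ i.+1 **
    (apow (star (w i)) a ** (apow (w i) p ** (if b == q then Y else 0))).
  by rewrite -right /corner_entry /conjug !amulA.
case: (b == q); last by rewrite andbF !amul0r.
by rewrite andbT shift_unit_left.
Qed.

(** The words of the next level contribute a single entry. The Laurent words
    are simply subtracted: their compressions are contractions, and a crude
    bound on their number is good enough. *)
Lemma corner_entry_normal_form i d c (T : nat -> nat -> A) a b :
  (forall p q, tspan w i.+1 d (T p q)) -> (a <= d)%N -> (b <= d)%N ->
  T a b = corner_entry i a b (normal_form w i d c T)
        - \sum_(p < d.+1) \sum_(q < d.+1)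
            c p q *: corner_entry i a b (conjug w i p q (src_ i)).
Proof.
move=> hT ad bd; have elin := corner_entry_lin i a b.
rewrite /normal_form (lin_sum elin) -sumrB.
under [RHS]eq_bigr => p _ do rewrite (lin_sum elin) -sumrB.
have termE (p q : nat) : corner_entry i a b (conjug w i p q (c p q *: src_ i + T p q)) -
    c p q *: corner_entry i a b (conjug w i p q (src_ i)) =
    if (a == p) && (b == q) then T p q else 0.
  rewrite conjug_lin elin addrAC subrr add0r.
  by rewrite corner_entry_conjug // ?(tsource_tspan w_rel (hT _ _))
    ?(tspan_tsource w_rel (hT _ _)).
under eq_bigr => p _ do under eq_bigr => q _ do rewrite termE.
rewrite -{1}(sum2_delta T ad bd); apply: eq_bigr => p _; apply: eq_bigr => q _.
by rewrite (eq_sym a) (eq_sym b).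
Qed.

End CornerEntries.

Section Comparison.
Variables (K : numClosedFieldType) (n : nat) (A : unitalStarAlgType K).
Variable w : nat -> A.
Hypothesis w_rel : tower_relations n w.
Local Notation src_ := (tsource w).

Section Contractions.
Variables (B : unitalCStarAlgType K) (f : A -> B).
Hypothesis hf : unital_star_hom f.

Let mf := let: conj (conj (conj _ h) _) _ := hf in h.
Let lf := let: conj (conj (conj h _) _) _ := hf in h.
Let sf := let: conj (conj _ h) _ := hf in h.

Lemma norm_gen_le1 i : `|f (w i)| <= 1.
Proof.
by apply: cstar_norm_partial_isometry; rewrite -sf -!mf (tower_source w_rel).
Qed.

Lemma norm_source_le1 i : `|f (src_ i)| <= 1.
Proof.
apply: cstar_norm_idem; rewrite -sf -mf star_tsource.
by rewrite (tsourceM w_rel).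
Qed.

Lemma norm_mul_le (x y : A) (a b : K) : `|f x| <= a -> `|f y| <= b ->
  `|f (x ** y)| <= a * b.
Proof.
by move=> xa yb; rewrite mf (le_trans (norm_amul _ _)) // ler_pM.
Qed.

Lemma norm_apow_le1 x k : `|f x| <= 1 -> `|f (apow x k)| <= 1.
Proof.
move=> x1; elim: k => [|k IH].
  apply: cstar_norm_idem; by rewrite -sf -mf star1 amul1l.
by rewrite apowS -[1]mulr1; exact: norm_mul_le.
Qed.

Lemma norm_star_gen_le1 i : `|f (star (w i))| <= 1.
Proof. by rewrite sf cstar_norm_star norm_gen_le1. Qed.

Lemma norm_conjug_le i p q x : `|f (conjug w i p q x)| <= `|f x|.
Proof.
rewrite -[leRHS]mul1r -[leRHS]mulr1; do 2?apply: norm_mul_le => //.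
- exact/norm_apow_le1/norm_gen_le1.
- exact/norm_apow_le1/norm_star_gen_le1.
Qed.

Lemma norm_corner_entry_le i a b x : `|f (corner_entry w i a b x)| <= `|f x|.
Proof.
have e1 : `|f x| = 1 * (1 * `|f x| * 1) * 1 by rewrite !mul1r !mulr1.
rewrite e1; do 4?apply: norm_mul_le => //; try exact: norm_source_le1.
- exact/norm_apow_le1/norm_star_gen_le1.
- exact/norm_apow_le1/norm_gen_le1.
Qed.

Lemma norm_sum2_le (d : nat) (F : nat -> nat -> A) (M : K) :
  (forall p q, (p <= d)%N -> (q <= d)%N -> `|f (F p q)| <= M) ->
  `|f (\sum_(p < d.+1) \sum_(q < d.+1) F p q)| <= M *+ d.+1 ^ 2.
Proof.
move=> FM; have sum_const (a : K) : a *+ d.+1 = \sum_(p < d.+1) a.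
  by rewrite sumr_const card_ord.
rewrite (lin_sum lf) expnS expn1 mulrnA sum_const.
rewrite (le_trans (ler_norm_sum _ _ _)) //; apply: ler_sum => p _.
rewrite (lin_sum lf) sum_const.
rewrite (le_trans (ler_norm_sum _ _ _)) //; apply: ler_sum => q _.
by apply: FM; rewrite -ltnS.
Qed.

End Contractions.

(* [g] is the morphism that sees the coefficients of normal forms; [f] is
   arbitrary. *)
Variables (B C : unitalCStarAlgType K) (g : A -> B) (f : A -> C).
Hypotheses (hg : unital_star_hom g) (hf : unital_star_hom f).
Hypothesis coeff_le : forall i d c (T : nat -> nat -> A), (i <= n)%N ->
  laurent_coeff c -> (forall p q, tspan w i.+1 d (T p q)) ->
  forall p q, (p <= d)%N -> (q <= d)%N ->
  `|c p q| <= `|g (normal_form w i d c T)|.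

Let lg := let: conj (conj (conj h _) _) _ := hg in h.
Let lf := let: conj (conj (conj h _) _) _ := hf in h.

Lemma tail_norm_le i d c (T : nat -> nat -> A) a b : (i <= n)%N ->
  laurent_coeff c -> (forall p q, tspan w i.+1 d (T p q)) ->
  (a <= d)%N -> (b <= d)%N ->
  `|g (T a b)| <= `|g (normal_form w i d c T)| *+ (d.+1 ^ 2).+1.
Proof.
move=> i_n hc hT ad bd; rewrite (corner_entry_normal_form w_rel c hT ad bd).
rewrite (linB lg) (le_trans (ler_normB _ _)) // mulrS lerD //.
  exact: norm_corner_entry_le.
apply: (norm_sum2_le hg (F := fun p q => c p q *:
  corner_entry w i a b (conjug w i p q (src_ i)))) => p q pd qd.
rewrite (linZ lg) normrZ -[leRHS]mulr1 ler_pM //; first exact: coeff_le.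
apply: le_trans (norm_corner_entry_le hg _ _ _ _) _.
apply: le_trans (norm_conjug_le hg _ _ _ _) _; exact: norm_source_le1.
Qed.

(** Descending induction on the level: the coefficients of a normal form are
    bounded by [coeff_le], hence its entries by [tail_norm_le], and the
    [(d + 1)^2] terms of the sum are contracted versions of these. Above level
    [n] the corner is zero. *)
Lemma tspan_norm_le r i d x : (i + r = n.+1)%N -> tspan w i d x ->
  `|f x| <= `|g x| *+ ((d.+1 ^ 2).+2 ^ 2) ^ r.
Proof.
elim: r i x => [|r IH] i x ir hx.
  by rewrite (tspan_top w_rel hx) ?(lin0 lf) ?normr0 ?mul0rn //; lia.
have i_n : (i <= n)%N by lia.
have [c [T [hc hT ->]]] := tspan_normal_form hx.
set y := normal_form _ _ _ _ _; set D := (d.+1 ^ 2)%N.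
set M := (D.+2 ^ 2)%N; have M_gt0 : (0 < M ^ r)%N by rewrite expn_gt0.
have term_le p q : (p <= d)%N -> (q <= d)%N ->
    `|f (conjug w i p q (c p q *: src_ i + T p q))| <= `|g y| *+ (D.+2 * M ^ r).
  move=> pd qd; apply: le_trans (norm_conjug_le hf _ _ _ _) _.
  rewrite (linD lf) (linZ lf) (le_trans (ler_normD _ _)) //.
  apply: (@le_trans _ _ (`|g y| + `|g y| *+ (D.+1 * M ^ r))).
    rewrite lerD //.
      rewrite normrZ -[leRHS]mulr1 ler_pM ?coeff_le //; exact: norm_source_le1.
    have := IH i.+1 (T p q) _ (hT p q); rewrite addSnnS => /(_ ir).
    move/le_trans; apply; rewrite -/D -/M mulrnA lerMn2r.
    by rewrite (tail_norm_le i_n hc hT) ?orbT.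
  by rewrite -mulrS ler_wpMn2l // mulSn -add1n leq_add2r.
apply: le_trans (norm_sum2_le hf term_le) _.
rewrite -mulrnA ler_wpMn2l // -/D expnS mulnAC leq_mul2r.
by rewrite /M expnS expn1 leq_mul2l; apply/orP; right; lia.
Qed.

Lemma tspan_norm_eq0 r i d x : (i + r = n.+1)%N -> tspan w i d x ->
  g x = 0 -> x = 0.
Proof.
elim: r i x => [|r IH] i x ir hx gx.
  by rewrite (tspan_top w_rel hx) //; lia.
have i_n : (i <= n)%N by lia.
have [c [T [hc hT xE]]] := tspan_normal_form hx.
rewrite xE /normal_form big1 // => p _; rewrite big1 // => q _.
have pd : (p <= d)%N by rewrite -ltnS.
have qd : (q <= d)%N by rewrite -ltnS.
have := coeff_le i_n hc hT pd qd; rewrite -xE gx normr0 normr_le0 => /eqP ->.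
rewrite scale0r add0r (IH i.+1 (T p q)) ?conjug0 //; first by lia.
apply/eqP; rewrite -normr_le0.
by have := tail_norm_le i_n hc hT pd qd; rewrite -xE gx normr0 mul0rn.
Qed.

End Comparison.

(** * Removing the polynomial factor *)

Lemma linear_lt_exp2 (a b : nat) : exists l, (a + b * l < 2 ^ l)%N.
Proof.
pose t := (a + 2 * b)%N; exists (t + t)%N.
have : (t < 2 ^ t)%N by rewrite ltn_expl.
rewrite expnD; move: (2 ^ t)%N => s; rewrite /t; nia.
Qed.

Lemma exp2k_ge2 (R : realType) (r : R) : 1 < r -> exists j, 2 <= r ^+ (2 ^ j).
Proof.
move=> r1; have h0 : 0 < r - 1 by rewrite subr_gt0.
pose j := Num.truncn (r - 1)^-1; exists j.+1.
have jh : 1 <= (2 ^ j.+1)%:R * (r - 1).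
  rewrite -ler_pdivrMr // div1r; apply: le_trans (ltW (truncnS_gt _)) _.
  by rewrite ler_nat ltnW // ltn_expl.
have bernoulli N : 1 + N%:R * (r - 1) <= r ^+ N.
  elim: N => [|N IH]; first by rewrite mul0r addr0 expr0.
  rewrite exprS; apply: (@le_trans _ _ (r * (1 + N%:R * (r - 1)))).
    rewrite -natr1 -subr_ge0.
    have -> : r * (1 + N%:R * (r - 1)) - (1 + (N%:R + 1) * (r - 1)) =
      N%:R * (r - 1) ^+ 2 by ring.
    by rewrite mulr_ge0 // sqr_ge0.
  by rewrite ler_pM2l // (lt_trans _ r1).
by apply: le_trans (bernoulli _); rewrite -[2]/(1 + 1)%R lerD2l.
Qed.

(** If [x > y], then [(x / y)^(2^k)] grows doubly exponentially in [k] while the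
    factor, whose base is a polynomial in [2^k], grows exponentially. *)
Lemma le_of_polynomial_powers (R : realType) (x y : R) (d m : nat) :
  0 <= x -> 0 <= y ->
  (forall k, x ^+ (2 ^ k) <= y ^+ (2 ^ k) *+
     (((2 ^ k * d).+1 ^ 2).+2 ^ 2) ^ m) -> x <= y.
Proof.
move=> x0 y0 xy; rewrite leNgt; apply/negP => yx.
have [yE|yneq0] := eqVneq y 0.
  have := xy 0%N; rewrite yE expn0 !expr1 mul0rn => /(lt_le_trans yx).
  by rewrite yE ltxx.
have y_gt0 : 0 < y by rewrite lt_def yneq0.
have [j hj] : exists j, 2 <= (x / y) ^+ (2 ^ j).
  by apply: exp2k_ge2; rewrite ltr_pdivlMr ?mul1r.
pose M := ((9 * d.+1 ^ 4) ^ m)%N.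
(* [M] collects the part of the polynomial that is independent of [k]. *)
have poly_le k : ((((2 ^ k * d).+1 ^ 2).+2 ^ 2) ^ m <= M * 2 ^ (4 * m * k))%N.
  have -> : (2 ^ (4 * m * k) = ((2 ^ k) ^ 4) ^ m)%N.
    by rewrite -!expnM; congr expn; lia.
  rewrite /M -expnMn; case: {xy M} m => [|m] //; rewrite leq_exp2r //.
  have : (0 < 2 ^ k)%N by rewrite expn_gt0.
  move: (2 ^ k)%N => s s_gt0.
  have -> : (9 * d.+1 ^ 4 * s ^ 4 = (3 * (d.+1 * s) ^ 2) ^ 2)%N.
    have sq4 u : (u ^ 4 = (u ^ 2) ^ 2)%N by rewrite -expnM.
    by rewrite !sq4 !expnMn !mulnA.
  rewrite leq_exp2r //; have : ((s * d).+1 <= d.+1 * s)%N by nia.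
  have : (0 < d.+1 * s)%N by rewrite muln_gt0.
  by move: (d.+1 * s)%N ((s * d).+1)%N => u v; nia.
have [l] := linear_lt_exp2 (M + 4 * m * j) (4 * m).
rewrite ltnNge => /negP; apply.
have : (2 ^ (2 ^ l) <= M * 2 ^ (4 * m * (j + l)))%N.
  rewrite -(ler_nat R); apply: (@le_trans _ _ ((x / y) ^+ (2 ^ (j + l)))).
    by rewrite natrX expnD exprM lerXn2r ?nnegrE // exprn_ge0 // divr_ge0.
  rewrite expr_div_n ler_pdivrMr ?exprn_gt0 // mulr_natl.
  by apply: le_trans (xy _) _; rewrite ler_wpMn2l // exprn_ge0.
have : (M <= 2 ^ M)%N by rewrite ltnW // ltn_expl.
move=> h1 h2; have : (2 ^ (2 ^ l) <= 2 ^ (M + 4 * m * (j + l)))%N.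
  by rewrite expnD (leq_trans h2) // leq_mul2r h1 orbT.
by rewrite leq_exp2l // mulnDr addnA.
Qed.

Section SphereComparison.
Variables (R : realType) (n : nat) (A : unitalStarAlgType R[i]).
Variable z : 'I_n.+1 -> A.
Hypothesis A_sphere : sphere_algebra z.

Let w := ztower z.
Let w_rel : tower_relations n w := let: conj r _ := A_sphere in sphere_tower r.

(** Degree is defined through the action on the span, so that it is
    subadditive under products by definition. *)
Definition degree_le (d : nat) (a : A) : Prop :=
  forall e b, tspan w 0 e b -> tspan w 0 (d + e) (a ** b).

Lemma degree_le_trans d e a : (d <= e)%N -> degree_le d a -> degree_le e a.
Proof.
by move=> de ha k b /ha; apply: tspan_le; rewrite leq_add2r.
Qed.

Lemma degree_leM d e a b :
  degree_le d a -> degree_le e b -> degree_le (d + e) (a ** b).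
Proof. by move=> ha hb k x /hb /ha; rewrite addnA amulA. Qed.

Lemma degree_le_lin d c a b :
  degree_le d a -> degree_le d b -> degree_le d (c *: a + b).
Proof.
by move=> ha hb k x hx; rewrite amulDl amulZl; apply: tspan_lin; auto.
Qed.

Lemma tspan_degree d a : degree_le d a -> tspan w 0 d a.
Proof.
move=> ha; have := tspan_source w 0 0; rewrite /tsource (tower_unit w_rel).
by move=> /ha; rewrite addn0 amul1r.
Qed.

Fact degree_star_lin (c : R[i]) x y :
  (exists d, degree_le d x /\ degree_le d (star x)) ->
  (exists d, degree_le d y /\ degree_le d (star y)) ->
  exists d, degree_le d (c *: x + y) /\ degree_le d (star (c *: x + y)).
Proof.
move=> [d [hx hx']] [e [hy hy']]; exists (maxn d e).
rewrite starD starZ; split; apply: degree_le_lin.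
all: by [apply: degree_le_trans hx; rewrite leq_maxl
  |apply: degree_le_trans hx'; rewrite leq_maxl
  |apply: degree_le_trans hy; rewrite leq_maxr
  |apply: degree_le_trans hy'; rewrite leq_maxr].
Qed.

Fact degree_star_mul (x y : A) :
  (exists d, degree_le d x /\ degree_le d (star x)) ->
  (exists d, degree_le d y /\ degree_le d (star y)) ->
  exists d, degree_le d (x ** y) /\ degree_le d (star (x ** y)).
Proof.
move=> [d [hx hx']] [e [hy hy']]; exists (d + e)%N; rewrite starM.
by split; [exact: degree_leM | rewrite addnC; exact: degree_leM].
Qed.

(** The elements of finite degree with an adjoint of finite degree form a
    subalgebra that contains the generators. *)
Lemma sphere_degree a : exists d, degree_le d a /\ degree_le d (star a).
Proof.
have one_mem : exists d, degree_le d (aone : A) /\ degree_le d (star aone).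
  by exists 0%N; rewrite star1; split=> k b; rewrite amul1l add0n.
have star_mem x : (exists d, degree_le d x /\ degree_le d (star x)) ->
    exists d, degree_le d (star x) /\ degree_le d (star (star x)).
  by move=> [d [hx hx']]; exists d; rewrite starK.
pose Q := Subalg one_mem degree_star_lin degree_star_mul star_mem.
apply: (sphere_ind (Q := Q) A_sphere) => i; exists 1%N.
by split=> k b /(tspan_mul w_rel) /(_ i isT) []; rewrite /w ztowerE add1n.
Qed.

Variables (B C : unitalCStarAlgType R[i]) (g : A -> B) (f : A -> C).
Hypotheses (hg : unital_star_hom g) (hf : unital_star_hom f).
Hypothesis coeff_le : forall i d c (T : nat -> nat -> A), (i <= n)%N ->
  laurent_coeff c -> (forall p q, tspan w i.+1 d (T p q)) ->
  forall p q, (p <= d)%N -> (q <= d)%N ->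
  `|c p q| <= `|g (normal_form w i d c T)|.

Lemma sphere_hom_inj : injective g.
Proof.
have lg := hg.1.1.1; move=> a b gab; apply/eqP; rewrite -subr_eq0; apply/eqP.
have [d [hd _]] := sphere_degree (a - b).
apply: (tspan_norm_eq0 w_rel hg coeff_le (add0n n.+1) (tspan_degree hd)).
by rewrite (linB lg) gab subrr.
Qed.

Lemma cstar_norm_squaring (D : unitalCStarAlgType R[i]) (h : A -> D) (b : A) k :
  unital_star_hom h -> star b = b ->
  `|h (iter k (fun x => x ** x) b)| = `|h b| ^+ (2 ^ k).
Proof.
move=> [[[_ mh] sh] _] bb.
have star_iter l : star (iter l (fun x => x ** x) b) = iter l (fun x => x ** x) b.
  by elim: l => //= l IH; rewrite starM IH.
elim: k => [|k IH]; first by rewrite expr1.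
by rewrite iterS mh -{1}star_iter sh norm_cstar IH -exprM expnSr.
Qed.

(** The norm of [f a] is at most a polynomial in the degree of [a] times the
    norm of [g a]. Applied to the powers of [a^* a], this inequality gives the
    same one with constant 1, by the C*-identity. *)
Lemma sphere_norm_le a : `|f a| <= `|g a|.
Proof.
pose b := star a ** a; have bb : star b = b by rewrite starM starK.
have [d [hd hd']] := sphere_degree a.
have deg_b : degree_le (d + d) b by exact: degree_leM.
have deg_pow k : degree_le (2 ^ k * (d + d)) (iter k (fun x => x ** x) b).
  elim: k => [|k IH]; first by rewrite mul1n.
  by rewrite expnSr muln2 -addnn mulnDl; exact: degree_leM.
have normE (D : unitalCStarAlgType R[i]) (h : A -> D) (x : A) :
    `|h x| = (complex.Re `|h x|)%:C by rewrite RRe_real // normr_real.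
have norm_ge0 (D : unitalCStarAlgType R[i]) (h : A -> D) (x : A) :
    0 <= complex.Re `|h x| by rewrite -ler0c -normE.
have : `|f b| <= `|g b|.
  rewrite (normE _ f) (normE _ g) lecR.
  apply: (@le_of_polynomial_powers _ _ _ (d + d) n.+1) => // k.
  rewrite -lecR rmorphMn !rmorphXn /= -!normE.
  rewrite -!cstar_norm_squaring //.
  exact: (tspan_norm_le w_rel hg hf coeff_le (add0n n.+1) (tspan_degree (deg_pow k))).
rewrite /b; have [[[_ mf] sf] _] := hf; have [[[_ mg] sg] _] := hg.
by rewrite mf sf mg sg !norm_cstar ler_pXn2r ?nnegrE.
Qed.

End SphereComparison.

(** * Unordered sums of complex numbers *)

Section RealPart.
Variable R : realType.
Implicit Types x y : R.

Lemma realCX x n : (x ^+ n)%:C = x%:C ^+ n. Proof. exact: rmorphXn. Qed.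
Lemma realCM x y : (x * y)%:C = x%:C * y%:C. Proof. exact: rmorphM. Qed.
Lemma realCD x y : (x + y)%:C = x%:C + y%:C. Proof. exact: rmorphD. Qed.

End RealPart.

#[local] Existing Instance summability.totally_filter.

Section UnorderedSums.
Variables (R : realType) (I : choiceType).
Local Notation C := R[i].
Implicit Types (x y : I -> C) (l m : C) (X : {fset I}).

Definition has_sum x l : Prop :=
  forall e : R, 0 < e -> exists X0, forall X, (X0 `<=` X)%fset ->
    `|l - \sum_(i <- X) x i| < e%:C.

Lemma has_sum_cvg x l : has_sum x l ->
  summability.partial_sum (fun i => x i : C^o) @ @summability.totally I
    --> (l : C^o).
Proof.
move=> xl; apply/cvgrPdist_lt => e e0.
have eE : e = (complex.Re e)%:C by rewrite RRe_real // gtr0_real.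
have [|X0 hX0] := xl (complex.Re e); first by rewrite -ltcR -eE.
exists X0 => //= X X0X; rewrite eE /summability.partial_sum.
by have := hX0 X X0X; rewrite big_seq_fsetE.
Qed.

Lemma has_sum_sum x l : has_sum x l ->
  summability.sum (fun i => x i : C^o) = l.
Proof. by move=> /has_sum_cvg; exact: cvg_lim. Qed.

Lemma has_sum_unique x l m : has_sum x l -> has_sum x m -> l = m.
Proof. by move=> /has_sum_sum <- /has_sum_sum. Qed.

Lemma has_sum_ext x y l : x =1 y -> has_sum x l -> has_sum y l.
Proof. by move=> /funext ->. Qed.

Lemma has_sumD x y l m :
  has_sum x l -> has_sum y m -> has_sum (fun i => x i + y i) (l + m).
Proof.
move=> xl ym e e0; have e20 : 0 < e / 2 by rewrite divr_gt0.
have [X0 hX] := xl _ e20; have [Y0 hY] := ym _ e20.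
exists (X0 `|` Y0)%fset => Z; rewrite fsubUset => /andP[/hX hZ /hY hZ'].
rewrite big_split /= opprD addrACA (le_lt_trans (ler_normD _ _)) //.
by rewrite (splitr e) rmorphD /= ltrD.
Qed.

Lemma has_sumZ (c : C) x l : has_sum x l -> has_sum (fun i => c * x i) (c * l).
Proof.
move=> xl e e0; pose M := complex.Re `|c| + 1.
have cE : `|c| = (complex.Re `|c|)%:C by rewrite RRe_real // normr_real.
have c_ge0 : 0 <= complex.Re `|c| by rewrite -ler0c -cE.
have M0 : 0 < M by rewrite ltr_wpDl.
have [|X0 hX] := xl (e / M); first by rewrite divr_gt0.
exists X0 => X /hX {}hX; rewrite -mulr_sumr -mulrBr normrM.
rewrite -[e](divfK (lt0r_neq0 M0)) mulrC rmorphM /=.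
have cM : `|c| <= M%:C by rewrite cE lecR lerDl.
apply: (@le_lt_trans _ _ (`|l - \sum_(i <- X) x i| * M%:C)).
  by apply: ler_pM.
by rewrite mulrC [ltRHS]mulrC ltr_pM2l // ltcR.
Qed.

Lemma has_sum_conj x l : has_sum x l -> has_sum (fun i => (x i)^*) l^*.
Proof.
move=> xl e /xl[X0 hX]; exists X0 => X /hX.
by rewrite -rmorph_sum -rmorphB /= norm_conjC.
Qed.

Lemma has_sum_fin x X : (forall i, i \notin X -> x i = 0) ->
  has_sum x (\sum_(i <- X) x i).
Proof.
move=> x0 e e0; exists X => Y XY.
rewrite (big_fset_incl _ XY) ?subrr ?normr0 ?ltcR // => i _; exact: x0.
Qed.

Lemma fsum_pmap (V : nmodType) (s : I -> option I) (x : I -> V) X :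
  (forall i i' j, s i = Some j -> s i' = Some j -> i = i') ->
  \sum_(i <- X) oapp x 0 (s i) = \sum_(j <- [fset j in pmap s X]%fset) x j.
Proof.
move=> s_inj; have uniq_s (r : seq I) : uniq r -> uniq (pmap s r).
  elim: r => //= i r IH /andP[ir /IH ur]; case si: (s i) => [j|] //=.
  rewrite ur andbT; apply: contra ir; rewrite mem_pmap => /mapP[k kr sk].
  by rewrite (s_inj _ _ _ si (esym sk)).
have pe : perm_eq [fset j in pmap s X]%fset (pmap s X).
  by apply: uniq_perm; rewrite ?fset_uniq ?uniq_s // => j; rewrite !inE.
rewrite (perm_big _ pe) /=; elim: (enum_fset X) => [|i r IH].
  by rewrite !big_nil.
by rewrite big_cons IH /=; case: (s i) => [j|]; rewrite ?big_cons ?add0r.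
Qed.

(** All nonzero terms have an index in the range of [s], so the partial sums of
    the two families correspond once the finite sets are large enough. *)
Lemma has_sum_reindex (s t : I -> option I) x l :
  (forall i j, s i = Some j <-> t j = Some i) ->
  (forall j, t j = None -> x j = 0) ->
  has_sum x l -> has_sum (fun i => oapp x 0 (s i)) l.
Proof.
move=> st x0 xl e e0; have [X0 hX] := xl e e0.
exists [fset i in pmap t X0]%fset => Y hY.
rewrite fsum_pmap; last by move=> i i' j /st ti /st; rewrite ti => -[].
rewrite (@big_fset_incl _ _ _ _ _ (X0 `|` [fset j in pmap s Y])%fset).
- by apply: hX; rewrite fsubsetUl.
- by rewrite fsubsetUr.
move=> j; rewrite !inE => /orP[jX0|->] // js; apply: x0.
case tj: (t j) => [i|] //; case/negP: js.
rewrite mem_pmap; apply/mapP; exists i; last by move/st: tj.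
apply: (fsubsetP hY); rewrite !inE mem_pmap.
by apply/mapP; exists j; rewrite ?tj.
Qed.

End UnorderedSums.

(** * Square summable families *)

Section Ell2Space.
Variables (R : realType) (I : choiceType).
Local Notation C := R[i].
Local Notation H := (ell2 R I).
Implicit Types (f g h : H) (c : C) (X : {fset I}).

Lemma ell2_addE f g i : (f + g) i = f i + g i. Proof. by []. Qed.
Lemma ell2_scaleE c f i : (c *: f) i = c * f i. Proof. by []. Qed.
Lemma ell2_0E i : (0 : H) i = 0. Proof. by []. Qed.

Lemma ell2_ext f g : (forall i, f i = g i) -> f = g.
Proof. by move=> fg; apply/val_inj/funext. Qed.

Lemma sqmod_norm (w : C) : (sqmod w)%:C = `|w| ^+ 2.
Proof. exact: add_Re2_Im2. Qed.

Lemma sqnorm_fin_num f : sqnorm f \is a fin_num.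
Proof.
by rewrite ge0_fin_numE ?sqnorm_ge0 //; have := valP f; rewrite inE.
Qed.

Lemma fsum_sqmod_le (x : I -> C) X :
  ((\sum_(i <- X) sqmod (x i))%:E <= sqnorm x)%E.
Proof.
rewrite -sumEFin; apply: ereal_sup_ubound; exists [set` X].
  by split; [exact: finite_fset|].
by rewrite fsbig_finite // set_fsetK.
Qed.

Lemma sqnorm_has_sum f :
  has_sum (fun i => (sqmod (f i))%:C) (fine (sqnorm f))%:C.
Proof.
have fE : sqnorm f = (fine (sqnorm f))%:E by rewrite fineK // sqnorm_fin_num.
move=> e e0; have [_ [A [finA _] <-]] :=
  ub_ereal_sup_adherent e0 (sqnorm_fin_num f).
rewrite -[ereal_sup _]/(sqnorm f) fE -EFinB fsbig_finite //=.
rewrite sumEFin lte_fin ltrBlDr => A_lt; exists (fset_set A) => X AX.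
rewrite -(rmorph_sum (real_complex R)) /= -rmorphB /= normc_def /=.
rewrite expr0n addr0 sqrtr_sqr ltcR ltr_norml.
have X_le : \sum_(i <- X) sqmod (f i) <= fine (sqnorm f).
  by rewrite -lee_fin -fE fsum_sqmod_le.
have X_ge : \sum_(i <- fset_set A) sqmod (f i) <= \sum_(i <- X) sqmod (f i).
  rewrite (big_fsetID _ (mem (fset_set A)) X) /=.
  rewrite (_ : [fset x in X | x \in fset_set A]%fset = fset_set A).
    by rewrite lerDl sumr_ge0 // => i _; exact: sqmod_ge0.
  apply/fsetP => i; rewrite !inE /= andbC; apply: andb_idr; exact: fsubsetP.
by apply/andP; split; lra.
Qed.

(** By polarization an inner product is a combination of four squared norms,
    so its terms are summable. *)
Lemma inner_has_sum f g : has_sum (fun i => (f i)^* * g i) (ell2_inner f g).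
Proof.
suff [l fg] : exists l, has_sum (fun i => (f i)^* * g i) l.
  by rewrite /ell2_inner (has_sum_sum fg).
have term (a c : C) := has_sumZ a (sqnorm_has_sum (f + c *: g)).
eexists; apply: has_sum_ext (has_sumD (has_sumD (term (4^-1)%:C 1)
  (term (- 4^-1)%:C (-1))) (has_sumD (term (0 -i* 4^-1)%C 'i%C)
  (term (0 +i* 4^-1)%C (- 'i%C)))) => i.
rewrite !ell2_addE !ell2_scaleE /sqmod.
case: (f i) (g i) => a b [c d].
apply/eqP; rewrite eq_complex /=; by apply/andP; split; apply/eqP => /=; field.
Qed.

Lemma inner_lin c f g h :
  ell2_inner f (c *: g + h) = c * ell2_inner f g + ell2_inner f h.
Proof.
apply: has_sum_unique (inner_has_sum f (c *: g + h)) _.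
apply: has_sum_ext (has_sumD (has_sumZ c (inner_has_sum f g)) (inner_has_sum f h)).
by move=> i; rewrite mulrDr mulrCA.
Qed.

Lemma inner_conj f g : (ell2_inner f g)^* = ell2_inner g f.
Proof.
apply: has_sum_unique (inner_has_sum g f).
apply: has_sum_ext (has_sum_conj (inner_has_sum f g)) => i.
by rewrite /= rmorphM /= conjCK mulrC.
Qed.

Lemma inner_sqnorm f : ell2_inner f f = (ell2_norm f ^+ 2)%:C.
Proof.
have -> : ell2_norm f ^+ 2 = fine (sqnorm f).
  by rewrite sqr_sqrtr // fine_ge0 // sqnorm_ge0.
apply: has_sum_unique (inner_has_sum f f) _.
apply: has_sum_ext (sqnorm_has_sum f) => i.
by rewrite sqmod_norm normCK mulrC.
Qed.

Lemma inner_ket f (k : I) : ell2_inner (ket R k) f = f k.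
Proof.
apply: has_sum_unique (inner_has_sum _ _) _.
have := @has_sum_fin _ _ (fun i => (ket R k i)^* * f i) [fset k]%fset.
rewrite big_seq_fset1 /= eqxx conjC1 mul1r; apply=> i.
by rewrite inE => /negbTE ik; rewrite ik conjC0 mul0r.
Qed.

Lemma innerDr f g h :
  ell2_inner f (g + h) = ell2_inner f g + ell2_inner f h.
Proof. by rewrite -[g]scale1r inner_lin mul1r scale1r. Qed.

Lemma inner0r f : ell2_inner f 0 = 0.
Proof. by apply/(addrI (ell2_inner f 0)); rewrite -innerDr !addr0. Qed.

Lemma inner0l f : ell2_inner 0 f = 0.
Proof. by rewrite -inner_conj inner0r conjC0. Qed.

Lemma innerZr c f g : ell2_inner f (c *: g) = c * ell2_inner f g.
Proof. by rewrite -[c *: g]addr0 inner_lin inner0r addr0. Qed.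

Lemma innerBr f g h :
  ell2_inner f (g - h) = ell2_inner f g - ell2_inner f h.
Proof. by rewrite innerDr -scaleN1r innerZr mulN1r. Qed.

Lemma innerDl f g h :
  ell2_inner (f + g) h = ell2_inner f h + ell2_inner g h.
Proof. by rewrite -inner_conj innerDr rmorphD /= !inner_conj. Qed.

Lemma innerZl c f g : ell2_inner (c *: f) g = c^* * ell2_inner f g.
Proof. by rewrite -inner_conj innerZr rmorphM /= inner_conj. Qed.

Lemma innerBl f g h :
  ell2_inner (f - g) h = ell2_inner f h - ell2_inner g h.
Proof. by rewrite -inner_conj innerBr rmorphB /= !inner_conj. Qed.

Lemma ell2_normE f : `|ell2_inner f f| = (ell2_norm f ^+ 2)%:C.
Proof. by rewrite inner_sqnorm ger0_norm // ler0c sqr_ge0. Qed.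

Lemma ell2_norm_ge0 f : 0 <= ell2_norm f.
Proof. exact: sqrtr_ge0. Qed.

Lemma inner_ker f g : (forall h, ell2_inner h f = ell2_inner h g) -> f = g.
Proof. by move=> fg; apply: ell2_ext => i; rewrite -!inner_ket. Qed.

Lemma coord_le f k : `|f k| <= (ell2_norm f)%:C.
Proof.
have fE : sqnorm f = (fine (sqnorm f))%:E by rewrite fineK // sqnorm_fin_num.
rewrite -(ler_pXn2r (n := 2)) ?nnegrE ?normr_ge0 ?ler0c ?ell2_norm_ge0 //.
rewrite -sqmod_norm -realCX lecR sqr_sqrtr ?fine_ge0 ?sqnorm_ge0 //.
have := fsum_sqmod_le f [fset k]%fset.
by rewrite big_seq_fset1 fE lee_fin.
Qed.

Lemma ell2_norm_eq0 f : ell2_norm f = 0 -> f = 0.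
Proof.
move=> f0; apply: ell2_ext => i; apply/eqP; rewrite -normr_le0.
by have := coord_le f i; rewrite f0.
Qed.

Lemma ell2_normZ c f : (ell2_norm (c *: f))%:C = `|c| * (ell2_norm f)%:C.
Proof.
apply/eqP; rewrite -(eqrXn2 (n := 2)) ?mulr_ge0 ?normr_ge0 ?ler0c ?ell2_norm_ge0 //.
rewrite -realCX -inner_sqnorm innerZl innerZr inner_sqnorm exprMn.
by rewrite realCX mulrA normCKC.
Qed.

Lemma ell2_norm0 : @ell2_norm R I 0 = 0.
Proof.
by apply: complexI; have := ell2_normZ 0 0; rewrite scale0r normr0 mul0r.
Qed.

Lemma ell2_normN f : ell2_norm (- f) = ell2_norm f.
Proof. by apply: complexI; rewrite -scaleN1r ell2_normZ normrN1 mul1r. Qed.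

Lemma norm_ket (k : I) : ell2_norm (ket R k) = 1.
Proof.
have := inner_ket (ket R k) k; rewrite inner_sqnorm /= eqxx => /complexI k1.
by apply/eqP; rewrite -(eqrXn2 (n := 2)) ?ell2_norm_ge0 // k1 expr1n.
Qed.

Lemma inner_le f g : `|ell2_inner f g| <= (ell2_norm f * ell2_norm g)%:C.
Proof.
have [->|g0] := eqVneq g 0.
  by rewrite -[0](scale0r 0) innerZr mul0r normr0 ler0c mulr_ge0 ?ell2_norm_ge0.
have ng0 : 0 < ell2_norm g.
  by rewrite lt_def ell2_norm_ge0 andbT; apply: contra_neq g0; exact: ell2_norm_eq0.
(* The projection of [f] onto the line of [g] is [c *: g]. *)
pose c := ell2_inner g f / (ell2_norm g ^+ 2)%:C.
have cg : ell2_inner g (f - c *: g) = 0.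
  rewrite innerBr innerZr inner_sqnorm divfK ?subrr //.
  by rewrite (inj_eq (@complexI R) _ 0) expf_neq0 // gt_eqF.
have : 0 <= ell2_inner (f - c *: g) (f - c *: g).
  by rewrite inner_sqnorm ler0c sqr_ge0.
rewrite innerBl innerZl cg mulr0 subr0 innerBr innerZr inner_sqnorm subr_ge0.
rewrite /c mulrAC -(inner_conj f g) -normCKC.
rewrite ler_pdivrMr; last by rewrite ltcR exprn_gt0.
rewrite -realCM -exprMn realCX.
by rewrite ler_pXn2r ?nnegrE ?normr_ge0 // ler0c mulr_ge0 ?ell2_norm_ge0.
Qed.

Lemma ell2_normD f g : ell2_norm (f + g) <= ell2_norm f + ell2_norm g.
Proof.
have fg0 : 0 <= ell2_norm f + ell2_norm g by rewrite addr_ge0 ?ell2_norm_ge0.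
rewrite -(ler_pXn2r (n := 2)) ?nnegrE ?ell2_norm_ge0 // -lecR -ell2_normE.
rewrite innerDl !innerDr !inner_sqnorm.
apply: le_trans (ler_normD _ _) _.
apply: le_trans (lerD (ler_normD _ _) (ler_normD _ _)) _.
have normE h : `|(ell2_norm h ^+ 2)%:C| = (ell2_norm h ^+ 2)%:C.
  by rewrite ger0_norm // ler0c sqr_ge0.
rewrite !normE.
apply: (@le_trans _ _ ((ell2_norm f ^+ 2)%:C + (ell2_norm f * ell2_norm g)%:C
  + ((ell2_norm g * ell2_norm f)%:C + (ell2_norm g ^+ 2)%:C))).
  by apply: lerD; apply: lerD; rewrite ?lexx //; exact: inner_le.
by rewrite -!realCD lecR sqrrD; lra.
Qed.

Lemma ell2_normB f g : ell2_norm (f - g) <= ell2_norm f + ell2_norm g.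
Proof. by rewrite -(ell2_normN g) ell2_normD. Qed.

End Ell2Space.

(** * Bounded operators with an adjoint *)

Section OperatorNorm.
Variables (R : realType) (I : choiceType).
Local Notation C := R[i].
Local Notation H := (ell2 R I).
Implicit Types (f g h : H) (T S : H -> H).

Definition op_bound (T : H -> H) (M : R) : Prop :=
  0 <= M /\ forall f, ell2_norm (T f) <= M * ell2_norm f.

Definition op_adjoint (T S : H -> H) : Prop :=
  forall f g, ell2_inner (S f) g = ell2_inner f (T g).

Definition opnorm (T : H -> H) : R := inf [set M | op_bound T M].

Lemma opnorm_ge0 T : 0 <= opnorm T.
Proof.
rewrite /opnorm; have [->|/set0P TM] := eqVneq [set M | op_bound T M] set0.
  by rewrite inf0.
by apply: lb_le_inf => // M [].
Qed.

Lemma opnorm_le T M : op_bound T M -> opnorm T <= M.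
Proof. by move=> TM; apply: ge_inf => //; exists 0 => N []. Qed.

Lemma opnormP T M f : op_bound T M -> ell2_norm (T f) <= opnorm T * ell2_norm f.
Proof.
move=> [M0 TM]; have [f0|f_neq0] := eqVneq (ell2_norm f) 0.
  by rewrite f0 mulr0; have := TM f; rewrite f0 mulr0.
have f_gt0 : 0 < ell2_norm f by rewrite lt_def f_neq0 ell2_norm_ge0.
rewrite -ler_pdivrMr //; apply: lb_le_inf; first by exists M.
by move=> N [_ TN]; rewrite ler_pdivrMr.
Qed.

Lemma adjoint_sym T S : op_adjoint T S -> op_adjoint S T.
Proof. by move=> TS f g; rewrite -inner_conj -TS inner_conj. Qed.

Lemma adjoint_linear T S : op_adjoint T S -> linear T.
Proof.
move=> TS c f g; apply: inner_ker => h.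
by rewrite -TS !inner_lin !TS.
Qed.

Lemma adjoint_unique T S S' : op_adjoint T S -> op_adjoint T S' -> S = S'.
Proof.
move=> TS TS'; apply/funext => f; apply: inner_ker => h.
by rewrite -inner_conj TS -TS' inner_conj.
Qed.

Lemma adjoint_bound T S M : op_adjoint T S -> op_bound T M -> op_bound S M.
Proof.
move=> TS [M0 TM]; split=> // f.
have [->|Sf0] := eqVneq (ell2_norm (S f)) 0.
  by rewrite mulr_ge0 // ell2_norm_ge0.
have Sf_gt0 : 0 < ell2_norm (S f) by rewrite lt_def Sf0 ell2_norm_ge0.
rewrite -(ler_pM2r Sf_gt0) -expr2 -lecR -ell2_normE TS.
apply: le_trans (inner_le _ _) _; rewrite lecR mulrC mulrAC.
by apply: ler_wpM2r; rewrite ?ell2_norm_ge0 // mulrC.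
Qed.

Lemma adjoint_opnorm T S : op_adjoint T S -> opnorm S = opnorm T.
Proof.
move=> TS; congr inf; apply/seteqP; split=> M /=; last exact: adjoint_bound.
exact/adjoint_bound/adjoint_sym.
Qed.

Lemma sqnorm_le (x : I -> C) (b : R) :
  (forall X : {fset I}, \sum_(i <- X) sqmod (x i) <= b) ->
  (sqnorm x <= b%:E)%E.
Proof.
move=> xb; apply: ge_ereal_sup => _ [A [finA _] <-].
by rewrite fsbig_finite // sumEFin lee_fin.
Qed.

Lemma fsum_sqmod_norm_le f (X : {fset I}) :
  \sum_(i <- X) sqmod (f i) <= ell2_norm f ^+ 2.
Proof.
rewrite sqr_sqrtr ?fine_ge0 ?sqnorm_ge0 // -lee_fin fineK ?sqnorm_fin_num //.
exact: fsum_sqmod_le.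
Qed.

Lemma ell2_norm_le f (b : R) : 0 <= b ->
  (forall X : {fset I}, \sum_(i <- X) sqmod (f i) <= b ^+ 2) ->
  ell2_norm f <= b.
Proof.
move=> b0 fb; rewrite -(ler_pXn2r (n := 2)) ?nnegrE ?ell2_norm_ge0 //.
rewrite sqr_sqrtr ?fine_ge0 ?sqnorm_ge0 // -lee_fin fineK ?sqnorm_fin_num //.
exact: sqnorm_le.
Qed.

(** A uniformly Cauchy filter of operators converges: coordinatewise limits
    exist because the scalars are complete, and the bounds on finite sets of
    coordinates pass to the limit. *)
Lemma op_limit (X : Type) (F : set_system X) (Phi : X -> H -> H) :
  ProperFilter F ->
  (forall e : R, 0 < e -> exists x0,
     F [set x | forall f, ell2_norm (Phi x f - Phi x0 f) <= e * ell2_norm f]) ->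
  exists T : H -> H, forall e : R, 0 < e ->
     F [set x | forall f, ell2_norm (T f - Phi x f) <= e * ell2_norm f].
Proof.
move=> FF cauchyF.
have part_cvg (phi : C -> R) f i : {morph phi : u v / u - v} ->
    (forall w, phi w ^+ 2 <= sqmod w) -> cvg ((fun x => phi (Phi x f i)) @ F).
  move=> phiB phi_le; apply: cauchy_cvg; apply/cauchyP => e e0.
  have f1_gt0 : 0 < ell2_norm f + 1 by rewrite ltr_wpDl // ell2_norm_ge0.
  have [|x0 Fx0] := cauchyF (e / (ell2_norm f + 1)); first by rewrite divr_gt0.
  exists (phi (Phi x0 f i)).
  suff : F [set x | ball (phi (Phi x0 f i)) e (phi (Phi x f i))] by [].
  apply: filterS Fx0 => x /(_ f) /= x_x0; rewrite -ball_normE /= distrC -phiB.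
  apply: (@le_lt_trans _ _ (e / (ell2_norm f + 1) * ell2_norm f)); last first.
    by rewrite mulrAC ltr_pdivrMr // ltr_pM2l // ltrDl.
  apply: le_trans x_x0; rewrite -(ler_pXn2r (n := 2)) ?nnegrE ?ell2_norm_ge0 //.
  rewrite real_normK ?num_real //; apply: le_trans (phi_le _) _.
  by have := fsum_sqmod_norm_le (Phi x f - Phi x0 f) [fset i]%fset;
    rewrite big_seq_fset1.
have re_cvg f i : cvg ((fun x => complex.Re (Phi x f i)) @ F).
  apply: part_cvg => [[? ?] [? ?] //|w].
  by rewrite lerDl sqr_ge0.
have im_cvg f i : cvg ((fun x => complex.Im (Phi x f i)) @ F).
  apply: part_cvg => [[? ?] [? ?] //|w].
  by rewrite lerDr sqr_ge0.
pose T0 f i : C^o := Complex (lim ((fun x => complex.Re (Phi x f i)) @ F))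
                             (lim ((fun x => complex.Im (Phi x f i)) @ F)).
have sum_cvg f (w : I -> C) (r : seq I) :
    (fun x => \sum_(i <- r) sqmod (Phi x f i - w i)) @ F -->
    \sum_(i <- r) sqmod (T0 f i - w i).
  elim: r => [|i r IH].
    by rewrite big_nil; under eq_fun => x do rewrite big_nil; exact: cvg_cst.
  rewrite big_cons; under eq_fun => x do rewrite big_cons.
  apply: cvgD IH; rewrite /sqmod.
  have sqmodBE (u v : C) : complex.Re (u - v) ^+ 2 + complex.Im (u - v) ^+ 2 =
      (complex.Re u - complex.Re v) * (complex.Re u - complex.Re v) +
      (complex.Im u - complex.Im v) * (complex.Im u - complex.Im v).
    by case: u v => [? ?] [? ?]; rewrite !expr2.
  rewrite sqmodBE; under eq_fun => x do rewrite sqmodBE.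
  have re_d := cvgB (re_cvg f i) (cvg_cst (complex.Re (w i))).
  have im_d := cvgB (im_cvg f i) (cvg_cst (complex.Im (w i))).
  by apply: cvgD; [apply: cvgM; exact: re_d|apply: cvgM; exact: im_d].
have T0_near (e : R) x0 f (X' : {fset I}) : 0 <= e ->
    F [set x | forall f, ell2_norm (Phi x f - Phi x0 f) <= e * ell2_norm f] ->
    \sum_(i <- X') sqmod (T0 f i - Phi x0 f i) <= (e * ell2_norm f) ^+ 2.
  move=> e0 Fx0; apply: cvgr_to_le (sum_cvg f (Phi x0 f) X') _.
  apply: filterS Fx0 => x /(_ f) x_x0.
  apply: le_trans (fsum_sqmod_norm_le (Phi x f - Phi x0 f) X') _.
  by rewrite ler_pXn2r ?nnegrE ?mulr_ge0 ?ell2_norm_ge0.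
have T0_mem f : T0 f \in @ell2_pred R I.
  have [x0 Fx0] := cauchyF 1 ltr01.
  have d_mem : (fun i => T0 f i - Phi x0 f i) \in @ell2_pred R I.
    rewrite inE; apply: le_lt_trans (ltry ((1 * ell2_norm f) ^+ 2)).
    by apply: sqnorm_le => X'; exact: T0_near.
  have -> : T0 f = (fun i => T0 f i - Phi x0 f i) + (Phi x0 f : I -> C^o).
    by apply/funext => i; rewrite /= subrK.
  by rewrite rpredD //; exact: valP.
exists (fun f => Ell2 (T0_mem f)) => e e0.
have e20 : 0 < e / 2 by rewrite divr_gt0.
have [x0 Fx0] := cauchyF _ e20; apply: filterS (Fx0) => x x_x0 f.
have -> : Ell2 (T0_mem f) - Phi x f =
    (Ell2 (T0_mem f) - Phi x0 f) - (Phi x f - Phi x0 f).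
  by rewrite opprB addrA subrK.
apply: le_trans (ell2_normB _ _) _; rewrite [e in leRHS]splitr mulrDl lerD //.
apply: ell2_norm_le => [|X']; first by rewrite mulr_ge0 ?ell2_norm_ge0 ?ltW.
by apply: T0_near Fx0; exact: ltW.
Qed.

End OperatorNorm.

Section BoundedOperators.
Variables (R : realType) (I : choiceType).
Local Notation C := R[i].
Local Notation H := (ell2 R I).
Implicit Types (f g h : H) (T S : H -> H).

(** Linearity is left out: it follows from the existence of an adjoint. *)
Definition bop_pred : {pred (H -> H)} := [pred T |
  `[< (exists M, op_bound T M) /\ (exists S, op_adjoint T S) >]].

Lemma bop_predP T : reflect
  ((exists M, op_bound T M) /\ (exists S, op_adjoint T S)) (T \in bop_pred).
Proof. exact: asboolP. Qed.

Lemma op_bound_lin (c : C) T S M N : op_bound T M -> op_bound S N ->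
  op_bound (c *: T + S) (complex.Re `|c| * M + N).
Proof.
have cE : (complex.Re `|c|)%:C = `|c| by rewrite RRe_real // normr_real.
have c0 : 0 <= complex.Re `|c| by rewrite -ler0c cE.
move=> [M0 TM] [N0 SN]; split; first by rewrite addr_ge0 // mulr_ge0.
move=> f; apply: le_trans (ell2_normD _ _) _; rewrite mulrDl lerD //.
rewrite -lecR ell2_normZ -cE -realCM lecR -mulrA.
exact: ler_wpM2l.
Qed.

Lemma op_adjoint_lin (c : C) T S T' S' : op_adjoint T T' -> op_adjoint S S' ->
  op_adjoint (c *: T + S) (c^* *: T' + S').
Proof.
move=> hT hS f g.
rewrite [LHS](innerDl (c^* *: T' f)) innerZl conjCK hT hS.
by rewrite [RHS](innerDr _ (c *: T g)) innerZr.
Qed.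

Lemma bop_submod_closed : submod_closed bop_pred.
Proof.
split.
  apply/bop_predP; split.
    by exists 0; split=> // f; rewrite /= mul0r [_ f]/(0 : H) ell2_norm0.
  by exists 0 => f g; exact: etrans (inner0l g) (esym (inner0r f)).
move=> c T S /bop_predP[[M TM] [T' hT]] /bop_predP[[N SN] [S' hS]].
apply/bop_predP; split; first by eexists; exact: op_bound_lin TM SN.
by eexists; exact: op_adjoint_lin hT hS.
Qed.

HB.instance Definition _ :=
  GRing.isSubmodClosed.Build C (H -> H) bop_pred bop_submod_closed.

Record bop := Bop { bop_val :> H -> H; _ : bop_val \in bop_pred }.
HB.instance Definition _ := [isSub for bop_val].
HB.instance Definition _ := [Choice of bop by <:].
HB.instance Definition _ := [SubChoice_isSubLmodule of bop by <:].

Implicit Types x y : bop.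

Definition bop_make T M S (TM : op_bound T M) (TS : op_adjoint T S) : bop :=
  Bop (introT (bop_predP T)
    (conj (ex_intro (op_bound T) M TM) (ex_intro (op_adjoint T) S TS))).

Lemma bop_ext x y : (forall f, x f = y f) -> x = y.
Proof. by move=> xy; apply/val_inj/funext. Qed.

Lemma bop_bound x : op_bound x (opnorm x).
Proof.
have /bop_predP [[M xM] _] := valP x.
by split=> [|f]; [exact: opnorm_ge0 | exact: opnormP xM].
Qed.

Definition bop_adj_fun x : H -> H :=
  projT1 (cid (elimT (bop_predP x) (valP x)).2).

Lemma bop_adj_funP x : op_adjoint x (bop_adj_fun x).
Proof. by rewrite /bop_adj_fun; case: cid. Qed.

Definition bop_adj x : bop :=
  bop_make (adjoint_bound (bop_adj_funP x) (bop_bound x))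
    (adjoint_sym (bop_adj_funP x)).

Lemma bop_adjP x f g : ell2_inner (bop_adj x f) g = ell2_inner f (x g).
Proof. exact: bop_adj_funP. Qed.

Lemma bop_adj_unique x S : op_adjoint x S -> bop_val (bop_adj x) = S.
Proof. exact/adjoint_unique/bop_adj_funP. Qed.

Lemma bop_linear x : linear x.
Proof. exact: adjoint_linear (bop_adj_funP x). Qed.

Lemma op_bound_comp T S M N : op_bound T M -> op_bound S N ->
  op_bound (T \o S) (M * N).
Proof.
move=> [M0 TM] [N0 SN]; split; first exact: mulr_ge0.
move=> f; apply: le_trans (TM _) _; rewrite -mulrA; exact: ler_wpM2l.
Qed.

Lemma op_adjoint_comp T S T' S' : op_adjoint T T' -> op_adjoint S S' ->
  op_adjoint (T \o S) (S' \o T').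
Proof. by move=> hT hS f g; rewrite /= hS hT. Qed.

Definition bop_mul x y : bop :=
  bop_make (op_bound_comp (bop_bound x) (bop_bound y))
    (op_adjoint_comp (bop_adj_funP x) (bop_adj_funP y)).

Lemma op_bound_id : op_bound (id : H -> H) 1.
Proof. by split=> // f; rewrite mul1r. Qed.

Lemma op_adjoint_id : op_adjoint (id : H -> H) id.
Proof. by []. Qed.

Definition bop_one : bop := bop_make op_bound_id op_adjoint_id.

Fact bop_mulA : associative bop_mul.
Proof. by move=> x y z; apply: bop_ext. Qed.

Lemma bop_addE x y f : (x + y) f = x f + y f. Proof. by []. Qed.
Lemma bop_scaleE (a : C) x f : (a *: x) f = a *: x f. Proof. by []. Qed.
Lemma bop_mulE x y f : bop_mul x y f = x (y f). Proof. by []. Qed.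

Fact bop_mulDl : left_distributive bop_mul +%R.
Proof.
by move=> x y z; apply: bop_ext => f; rewrite bop_addE !bop_mulE bop_addE.
Qed.

Fact bop_mulDr : right_distributive bop_mul +%R.
Proof.
move=> x y z; apply: bop_ext => f.
by rewrite bop_addE !bop_mulE bop_addE (linD (bop_linear x)).
Qed.

Fact bop_mulZl (a : C) x y : bop_mul (a *: x) y = a *: bop_mul x y.
Proof. by apply: bop_ext => f; rewrite bop_scaleE !bop_mulE bop_scaleE. Qed.

Fact bop_mulZr (a : C) x y : bop_mul x (a *: y) = a *: bop_mul x y.
Proof.
apply: bop_ext => f.
by rewrite bop_scaleE !bop_mulE bop_scaleE (linZ (bop_linear x)).
Qed.

HB.instance Definition _ := Lmodule_hasAlgMul.Build C bop
  bop_mulA bop_mulDl bop_mulDr bop_mulZl bop_mulZr.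

Fact bop_adjK : involutive bop_adj.
Proof.
by move=> x; apply/val_inj/bop_adj_unique/adjoint_sym/bop_adj_funP.
Qed.

Fact bop_adjD : {morph bop_adj : x y / x + y}.
Proof.
move=> x y; apply/val_inj/bop_adj_unique => f g.
by rewrite [LHS]innerDl !bop_adjP -innerDr.
Qed.

Fact bop_adjZ (a : C) x : bop_adj (a *: x) = a^* *: bop_adj x.
Proof.
apply/val_inj/bop_adj_unique => f g.
by rewrite [LHS]innerZl conjCK bop_adjP -innerZr.
Qed.

Fact bop_adjM x y : bop_adj (x ** y) = bop_adj y ** bop_adj x.
Proof.
by apply/val_inj/bop_adj_unique; apply: op_adjoint_comp; exact: bop_adj_funP.
Qed.

HB.instance Definition _ := AssocAlgebra_hasStar.Build C bop
  bop_adjK bop_adjD bop_adjZ bop_adjM.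

Fact bop_mul1l : left_id bop_one amul.
Proof. by move=> x; apply: bop_ext. Qed.

Fact bop_mul1r : right_id bop_one amul.
Proof. by move=> x; apply: bop_ext. Qed.

HB.instance Definition _ := AssocAlgebra_hasOne.Build C bop
  bop_mul1l bop_mul1r.

Definition bop_norm x : C := (opnorm x)%:C.

Fact bop_normD x y : bop_norm (x + y) <= bop_norm x + bop_norm y.
Proof.
rewrite /bop_norm -realCD lecR; apply: opnorm_le; split.
  by rewrite addr_ge0 // opnorm_ge0.
move=> f; apply: le_trans (ell2_normD _ _) _.
by rewrite mulrDl lerD // (bop_bound _).2.
Qed.

Lemma bop_norm_leZ (a : C) x : bop_norm (a *: x) <= `|a| * bop_norm x.
Proof.
have aE : `|a| = (complex.Re `|a|)%:C by rewrite RRe_real // normr_real.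
rewrite /bop_norm aE -realCM lecR; apply: opnorm_le; split.
  by rewrite mulr_ge0 ?opnorm_ge0 // -ler0c -aE.
move=> f; rewrite -lecR -mulrA realCM -aE [_ f]/(a *: x f) ell2_normZ.
by apply: ler_wpM2l => //; rewrite lecR (bop_bound x).2.
Qed.

Fact bop_normZ (a : C) x : bop_norm (a *: x) = `|a| * bop_norm x.
Proof.
apply/eqP; rewrite eq_le bop_norm_leZ /=.
have [->|a0] := eqVneq a 0; first by rewrite normr0 mul0r ler0c opnorm_ge0.
rewrite mulrC -ler_pdivlMr ?normr_gt0 // mulrC -normfV.
by apply: le_trans (bop_norm_leZ _ _); rewrite scalerA mulVf // scale1r.
Qed.

Fact bop_norm_eq0 x : bop_norm x = 0 -> x = 0.
Proof.
move=> /complexI x0; apply: bop_ext => f; apply: ell2_norm_eq0; apply/eqP.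
by rewrite eq_le ell2_norm_ge0 andbT; have := (bop_bound x).2 f; rewrite x0 mul0r.
Qed.

HB.instance Definition _ := Lmodule_isNormed.Build C bop
  bop_normD bop_normZ bop_norm_eq0.

Lemma bop_normE x : `|x| = (opnorm x)%:C. Proof. by []. Qed.

Lemma bop_norm_val_le x (e : R) f : `|x| <= e%:C ->
  ell2_norm (x f) <= e * ell2_norm f.
Proof.
rewrite bop_normE lecR => xe.
by apply: le_trans ((bop_bound x).2 f) _; rewrite ler_wpM2r ?ell2_norm_ge0.
Qed.

Lemma bop_norm_adj x : `|bop_adj x| = `|x|.
Proof. congr (_%:C); exact: adjoint_opnorm (bop_adj_funP x). Qed.

(** The filter of the adjoints is Cauchy as well, since taking adjoints is
    isometric; its limit is an adjoint of the limit. *)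
Fact bop_complete (F : set_system bop) :
  ProperFilter F -> cauchy F -> cvg F.
Proof.
move=> FF /cauchyP Fc.
have near_x0 (e : R) : 0 < e -> exists x0, F [set x | `|x - x0| <= e%:C].
  move=> e0; have [|x0 Fx0] := Fc e%:C; first by rewrite ltcR.
  by exists x0; apply: filterS Fx0 => x; rewrite -ball_normE /= distrC => /ltW.
have [T hT] : exists T : H -> H, forall e : R, 0 < e ->
    F [set x | forall f, ell2_norm (T f - (x : bop) f) <= e * ell2_norm f].
  apply: op_limit => e /near_x0[x0 Fx0]; exists x0; apply: filterS Fx0 => x x_x0 f.
  exact: (bop_norm_val_le f x_x0).
have [S hS] : exists S : H -> H, forall e : R, 0 < e ->
    F [set x | forall f, ell2_norm (S f - bop_adj x f) <= e * ell2_norm f].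
  apply: (op_limit (Phi := fun x : bop => bop_adj x)) => e /near_x0[x0 Fx0].
  exists x0; apply: filterS Fx0 => x; rewrite /= -bop_norm_adj => x_x0 f.
  have := bop_norm_val_le f x_x0.
  by rewrite [bop_adj _](@starB _ bop).
have TM : exists M, op_bound T M.
  have [x Fx] := filter_ex (hT 1 ltr01); exists (1 + opnorm x); split.
    by rewrite addr_ge0 ?opnorm_ge0.
  move=> f; rewrite -[T f](subrK (x f)) mulrDl.
  apply: le_trans (ell2_normD _ _) _; rewrite lerD //; exact: (bop_bound x).2.
have TS : op_adjoint T S.
  move=> f g; apply/eqP; rewrite -subr_eq0 -normr_le0.
  have nE : `|ell2_inner (S f) g - ell2_inner f (T g)| =
      (complex.Re `|ell2_inner (S f) g - ell2_inner f (T g)|)%:C.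
    by rewrite RRe_real // normr_real.
  rewrite nE lecR; apply/ler_addgt0Pl => e e0; rewrite addr0.
  pose m := ell2_norm f * ell2_norm g.
  have m0 : 0 <= m by rewrite mulr_ge0 ?ell2_norm_ge0.
  have m1_gt0 : 0 < 2 * m + 1 by rewrite ltr_wpDl // mulr_ge0.
  pose d := e / (2 * m + 1); have d_gt0 : 0 < d by rewrite divr_gt0.
  have [x [Tx Sx]] := filter_ex (filterI (hT _ d_gt0) (hS _ d_gt0)).
  rewrite -lecR -nE.
  have -> : ell2_inner (S f) g - ell2_inner f (T g) =
      ell2_inner (S f - bop_adj x f) g - ell2_inner f (T g - x g).
    by rewrite innerBl innerBr bop_adjP opprB addrA subrK.
  apply: le_trans (ler_normB _ _) _.
  apply: le_trans (lerD (inner_le _ _) (inner_le _ _)) _.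
  rewrite -realCD lecR.
  have le_d := lerD (ler_wpM2r (ell2_norm_ge0 g) (Sx f))
                    (ler_wpM2l (ell2_norm_ge0 f) (Tx g)).
  apply: le_trans le_d _.
  have -> : d * ell2_norm f * ell2_norm g + ell2_norm f * (d * ell2_norm g) =
      d * (2 * m) by rewrite /m; ring.
  by rewrite /d mulrAC ler_pdivrMr // ler_pM2l // lerDl.
have [M TM'] := TM; pose l := bop_make TM' TS.
apply/cvg_ex; exists l; apply/cvgrPdist_lt => e e0.
have eE : e = (complex.Re e)%:C by rewrite RRe_real // gtr0_real.
have e20 : 0 < complex.Re e / 2 by rewrite divr_gt0 // -ltcR -eE.
apply: filterS (hT _ e20) => x xl.
apply: (@le_lt_trans _ _ (complex.Re e / 2)%:C).
  rewrite lecR; apply: opnorm_le; split; first exact: ltW.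
  exact: xl.
by rewrite [ltRHS]eE ltcR; lra.
Qed.

HB.instance Definition _ := Uniform_isComplete.Build bop bop_complete.

Fact bop_norm_amul x y : `|x ** y| <= `|x| * `|y|.
Proof.
rewrite !bop_normE -realCM lecR; apply: opnorm_le.
by apply: op_bound_comp; exact: bop_bound.
Qed.

(** The Cauchy-Schwarz inequality applied to [|x f|^2 = <x^* x f, f>]. *)
Fact bop_norm_cstar x : `|star x ** x| = `|x| ^+ 2.
Proof.
apply/eqP; rewrite eq_le; apply/andP; split.
  by apply: le_trans (bop_norm_amul _ _) _; rewrite expr2 (bop_norm_adj x).
rewrite !bop_normE -realCX lecR; set N := opnorm (star x ** x).
have N0 : 0 <= N by exact: opnorm_ge0.
suff : opnorm x <= Num.sqrt N.
  move=> xN; rewrite -(sqr_sqrtr N0).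
  by rewrite ler_pXn2r ?nnegrE ?opnorm_ge0 ?sqrtr_ge0.
apply: opnorm_le; split=> [|f]; first exact: sqrtr_ge0.
rewrite -(ler_pXn2r (n := 2)) ?nnegrE ?mulr_ge0 ?sqrtr_ge0 ?ell2_norm_ge0 //.
rewrite exprMn (sqr_sqrtr N0) -lecR -ell2_normE -bop_adjP.
apply: le_trans (inner_le _ _) _; rewrite lecR expr2 mulrA.
by apply: ler_wpM2r; [exact: ell2_norm_ge0 | exact: (bop_bound (star x ** x)).2].
Qed.

HB.instance Definition _ := isCStarNorm.Build C bop
  bop_norm_amul bop_norm_cstar.

End BoundedOperators.

(** * Partial permutations of an orthonormal basis *)

(** Both directions are part of the data: they give the coordinates of an
    operator and of its adjoint. *)
Record pbij (I : Type) := Pbij {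
  pfwd : I -> option I;
  pbwd : I -> option I;
  pbijP : forall i j, pfwd i = Some j <-> pbwd j = Some i
}.

Definition pbij_inv (I : Type) (b : pbij I) : pbij I :=
  Pbij (fun i j => iff_sym (pbijP b j i)).

Section PbijOperator.
Variables (R : realType) (I : choiceType).
Local Notation C := R[i].
Local Notation H := (ell2 R I).
Implicit Types (b : pbij I) (f g : H).

Lemma pfwd_inj b i i' j : pfwd b i = Some j -> pfwd b i' = Some j -> i = i'.
Proof. by move=> /pbijP bi /pbijP; rewrite bi => -[]. Qed.

Definition pull b (f : I -> C^o) (i : I) : C^o := oapp f 0 (pfwd b i).

Lemma pull_fsum_le b f (X : {fset I}) :
  \sum_(i <- X) sqmod (pull b f i) <= ell2_norm f ^+ 2.
Proof.
have -> : \sum_(i <- X) sqmod (pull b f i) =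
    \sum_(i <- X) oapp (fun j => sqmod (f j)) 0 (pfwd b i).
  apply: eq_bigr => i _; rewrite /pull; case: (pfwd b i) => //=.
  exact: sqmod0.
rewrite (fsum_pmap _ _ (@pfwd_inj b)); exact: fsum_sqmod_norm_le.
Qed.

Lemma pull_mem b f : pull b f \in @ell2_pred R I.
Proof.
rewrite inE; apply: le_lt_trans (ltry (ell2_norm f ^+ 2)).
by apply: sqnorm_le => X; exact: pull_fsum_le.
Qed.

Definition pull_fun b f : H := Ell2 (pull_mem b f).

Lemma pull_bound b : op_bound (pull_fun b) 1.
Proof.
split=> // f; rewrite mul1r; apply: ell2_norm_le; first exact: ell2_norm_ge0.
by move=> X; exact: pull_fsum_le.
Qed.

Lemma pull_adjoint b : op_adjoint (pull_fun b) (pull_fun (pbij_inv b)).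
Proof.
move=> f g; apply: has_sum_unique (inner_has_sum f (pull_fun b g)).
have := has_sum_reindex (pbijP b) _ (inner_has_sum (pull_fun (pbij_inv b) f) g).
rewrite /= /pull /= => sum_fg; apply: has_sum_ext (sum_fg _) => [i|j ->].
  case bi: (pfwd b i) => [j|] /=; last by rewrite mulr0.
  by move/pbijP: bi => ->.
by rewrite /= conjC0 mul0r.
Qed.

Definition pop b : bop R I := bop_make (pull_bound b) (pull_adjoint b).

Lemma popE b f i : pop b f i = oapp f 0 (pfwd b i).
Proof. by []. Qed.

Lemma star_pop b : star (pop b) = pop (pbij_inv b).
Proof. exact/val_inj/bop_adj_unique/pull_adjoint. Qed.

Lemma star_popE b f i : star (pop b) f i = oapp f 0 (pbwd b i).
Proof. by rewrite star_pop. Qed.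

Lemma pop_ket b k : pop b (ket R k) = if pbwd b k is Some i then ket R i else 0.
Proof.
apply: ell2_ext => i; rewrite popE.
case bk: (pbwd b k) => [j|] /=.
  case bi: (pfwd b i) => [l|] /=.
    congr (_ %:R); congr nat_of_bool; apply/eqP/eqP => [lk|ij].
      by move: bi; rewrite lk => /pbijP; rewrite bk => -[].
    by move: bi; rewrite ij; move/pbijP: bk => -> [].
  by case: eqP bi => // ->; move/pbijP: bk => ->.
case bi: (pfwd b i) => [l|] //=; case: eqP bi => // -> /pbijP.
by rewrite bk.
Qed.

Lemma star_pop_ket b k :
  star (pop b) (ket R k) = if pfwd b k is Some i then ket R i else 0.
Proof. by rewrite star_pop pop_ket. Qed.

End PbijOperator.

(** * The shifts on the basis *)

Section Shifts.
Variable n : nat.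
Local Notation idx := (basis_index n).
Implicit Types (i j : nat) (k : idx).

Definition zero_below i k : bool :=
  [forall j : 'I_n, (j < i)%N ==> (k.1 j == 0%N)].

(** The last coordinate is an integer, which can always be decreased. *)
Definition pos_at i k : bool :=
  [forall j : 'I_n, (i == j :> nat) ==> (0 < k.1 j)%N].

Definition incr_at i k : idx :=
  ([ffun j : 'I_n => (k.1 j + (i == j :> nat))%N], k.2 + (i == n :> nat)%:Z).

Definition decr_at i k : idx :=
  ([ffun j : 'I_n => (k.1 j - (i == j :> nat))%N], k.2 - (i == n :> nat)%:Z).

Lemma idx_ext k (l : idx) : (forall j : 'I_n, k.1 j = l.1 j) -> k.2 = l.2 -> k = l.
Proof. by case: k l => [k1 k2] [l1 l2] /= /ffunP -> ->. Qed.

Lemma zero_belowP i k : reflect (forall j : 'I_n, (j < i)%N -> k.1 j = 0%N)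
  (zero_below i k).
Proof.
apply: (iffP forallP) => [h j ji|h j]; last by apply/implyP => /h ->.
by apply/eqP; have := h j; rewrite ji.
Qed.

Lemma pos_atP i k : reflect (forall j : 'I_n, i = j -> (0 < k.1 j)%N)
  (pos_at i k).
Proof.
apply: (iffP forallP) => [h j ij|h j]; last by apply/implyP => /eqP /h.
by have := h j; rewrite ij eqxx.
Qed.

Lemma incr_atK i k : decr_at i (incr_at i k) = k.
Proof. by apply: idx_ext => [j|]; rewrite /= ?ffunE ?addnK ?addrK. Qed.

Lemma decr_atK i k : pos_at i k -> incr_at i (decr_at i k) = k.
Proof.
move=> /pos_atP k_pos; apply: idx_ext => [j|]; rewrite /= ?ffunE ?subrK //.
by case: eqP => [/k_pos|]; lia.
Qed.

Lemma pos_at_incr i k : pos_at i (incr_at i k).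
Proof. by apply/pos_atP => j ij; rewrite /= ffunE ij eqxx addn1. Qed.

Lemma zero_below_incr i k : zero_below i (incr_at i k) = zero_below i k.
Proof.
apply/zero_belowP/zero_belowP => h j ji; have := h j ji.
  by rewrite /= ffunE gtn_eqF // addn0.
by move=> kj; rewrite /= ffunE kj gtn_eqF.
Qed.

Definition shift_fwd i k : option idx :=
  if zero_below i k && pos_at i k then Some (decr_at i k) else None.

Definition shift_bwd i k : option idx :=
  if zero_below i k then Some (incr_at i k) else None.

Fact shiftP i k l : shift_fwd i k = Some l <-> shift_bwd i l = Some k.
Proof.
rewrite /shift_fwd /shift_bwd; split.
  case: ifP => // /andP[zk pk] [<-].
  by rewrite -zero_below_incr decr_atK ?zk.
case: ifP => // zl [<-].
by rewrite zero_below_incr zl pos_at_incr incr_atK.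
Qed.

Definition shift i : pbij idx := Pbij (shiftP i).

Lemma zero_belowS i k : (i < n)%N ->
  zero_below i.+1 k = zero_below i k && ~~ pos_at i k.
Proof.
move=> i_n; apply/zero_belowP/andP => [h|[/zero_belowP h /pos_atP p] j].
  split; first by apply/zero_belowP => j ji; apply: h; exact: ltnW.
  apply/negP => /pos_atP /(_ (Ordinal i_n) erefl).
  by rewrite (h (Ordinal i_n)) /=.
rewrite ltnS leq_eqVlt => /predU1P[ij|]; last exact: h.
apply/eqP; rewrite -leqn0 leqNgt; apply/negP => kj; apply: p => a ia.
by rewrite (_ : a = j) //; apply/val_inj; rewrite /= -ia.
Qed.

Lemma pos_at_top k : pos_at n k.
Proof. by apply/pos_atP => j nj; have := ltn_ord j; rewrite -nj ltnn. Qed.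

Lemma zero_below_not_pos i j k : (j < i <= n)%N -> zero_below i k ->
  pos_at j k = false.
Proof.
move=> /andP[ji i_n] /zero_belowP zk; apply/negP => /pos_atP.
have j_n : (j < n)%N by exact: leq_trans i_n.
by move=> /(_ (Ordinal j_n) erefl); rewrite zk.
Qed.

Variable R : realType.
Local Notation C := R[i].
Local Notation op := (bop R idx).

Definition shift_op i : op := pop R (shift i).

Lemma shift_opE i (f : ell2 R idx) k : shift_op i f k =
  if zero_below i k && pos_at i k then f (decr_at i k) else 0.
Proof. by rewrite popE /= /shift_fwd; case: ifP. Qed.

Lemma star_shift_opE i (f : ell2 R idx) k : star (shift_op i) f k =
  if zero_below i k then f (incr_at i k) else 0.
Proof. by rewrite star_popE /= /shift_bwd; case: ifP. Qed.

Lemma shift_op_ket (i : 'I_n.+1) k : shift_op i (ket R k) = shift_ket R i k.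
Proof. by rewrite pop_ket /= /shift_bwd /zero_below /shift_ket; case: ifP. Qed.

Lemma shift_source_projE i (f : ell2 R idx) k :
  (star (shift_op i) ** shift_op i) f k = if zero_below i k then f k else 0.
Proof.
rewrite [LHS]star_shift_opE; case: ifP => // zk.
by rewrite shift_opE zero_below_incr zk pos_at_incr incr_atK.
Qed.

Lemma shift_range_projE i (f : ell2 R idx) k :
  (shift_op i ** star (shift_op i)) f k =
  if zero_below i k && pos_at i k then f k else 0.
Proof.
rewrite [LHS]shift_opE; case: ifP => // /andP[zk pk].
by rewrite star_shift_opE -zero_below_incr decr_atK ?zk.
Qed.

Lemma bop_sumE (J : Type) (r : seq J) (Q : pred J) (F : J -> op)
    (f : ell2 R idx) k :
  (\sum_(j <- r | Q j) F j) f k = \sum_(j <- r | Q j) F j f k.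
Proof.
exact: (big_morph (fun x : op => x f k : C) (fun x y => erefl) erefl).
Qed.

(** The range projection of the shift number [j] is the difference of the
    projections onto the vectors with zeros below [j] and below [j + 1], the
    latter being replaced by zero for [j = n]; the sum telescopes. *)
Lemma shift_range_sumE i (f : ell2 R idx) k : (i <= n)%N ->
  \sum_(i <= j < n.+1) (shift_op j ** star (shift_op j)) f k =
  if zero_below i k then f k else 0.
Proof.
move=> i_n.
pose a j : C := if (j <= n)%N && zero_below j k then f k else 0.
have step j : (i <= j < n.+1)%N ->
    (shift_op j ** star (shift_op j)) f k = a j - a j.+1.
  rewrite ltnS => /andP[_ j_n]; rewrite shift_range_projE /a j_n /=.
  move: j_n; rewrite leq_eqVlt => /predU1P[->|j_n].
    by rewrite ltnn /= pos_at_top andbT subr0.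
  rewrite j_n /= zero_belowS //.
  by case: (zero_below j k); case: (pos_at j k); rewrite ?subr0 ?subrr.
rewrite (eq_big_nat _ _ step).
under eq_bigr => j _ do rewrite -opprB.
by rewrite sumrN telescope_sumr ?(leqW i_n) // opprB /a ltnn i_n subr0.
Qed.

Lemma shift_sphere : sphere_relations (fun i : 'I_n.+1 => shift_op i).
Proof.
split.
- move=> i j ji; apply: bop_ext => f; apply: ell2_ext => k.
  rewrite [LHS]shift_opE; case: ifP => // /andP[zk _]; rewrite shift_opE.
  case: ifP => // /andP[_]; rewrite (zero_below_not_pos (i := i)) //.
    by rewrite ji -ltnS ltn_ord.
  apply/zero_belowP => a ai; rewrite /= ffunE.
  by move/zero_belowP: zk => ->.
- move=> i j ij; apply: bop_ext => f; apply: ell2_ext => k.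
  rewrite [LHS]star_shift_opE; case: ifP => // zk; rewrite shift_opE.
  have i_n : (i <= n)%N by rewrite -ltnS.
  have j_n : (j <= n)%N by rewrite -ltnS.
  case: ifP => // /andP[zk' pk'].
  have [lt_ij|lt_ji|/val_inj eq_ij] := ltngtP i j; last first.
  - by rewrite eq_ij eqxx in ij.
  - have := zero_below_not_pos (i := i) (j := j) (k := incr_at i k).
    by rewrite lt_ji i_n zero_below_incr zk pk' => /(_ isT isT).
  - have := zero_below_not_pos (i := j) (j := i) _ zk'.
    by rewrite lt_ij j_n pos_at_incr => /(_ isT).
- move=> i; apply: bop_ext => f; apply: ell2_ext => k.
  have i_n : (i <= n)%N by rewrite -ltnS.
  rewrite shift_source_projE bop_sumE -(shift_range_sumE f k i_n).
  by rewrite big_geq_mkord.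
- apply: bop_ext => f; apply: ell2_ext => k.
  rewrite bop_sumE -[RHS](_ : (if zero_below 0 k then f k else 0) = f k).
    by rewrite -(shift_range_sumE f k (leq0n n)) big_mkord.
  by case: zero_belowP => // -[].
Qed.

End Shifts.

Section ShiftCoefficients.
Variables (R : realType) (n : nat) (A : unitalStarAlgType R[i]).
Variable z : 'I_n.+1 -> A.
Hypothesis z_rel : sphere_relations z.
Local Notation idx := (basis_index n).
Variable pi : A -> bop R idx.
Hypothesis pi_hom : unital_star_hom pi.
Hypothesis pi_z : forall i, pi (z i) = shift_op n R i.

Let w := ztower z.
Let w_rel : tower_relations n w := sphere_tower z_rel.
Let lin_pi := let: conj (conj (conj h _) _) _ := pi_hom in h.

Let piM x y f : pi (x ** y) f = pi x (pi y f).
Proof. by have [[[_ ->] _] _] := pi_hom. Qed.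

Let pi_star x : pi (star x) = star (pi x).
Proof. by have [[_ ->] _] := pi_hom. Qed.

Let pi_w i : (i <= n)%N -> pi (w i) = shift_op n R i.
Proof.
by rewrite -ltnS => i_n; rewrite /w (ztower_ord z i_n) pi_z.
Qed.

(** Index of the [N]-th vector of the half-line (of the line, if [i = n]) on
    which [z_i] acts as a shift. *)
Definition ray i N : idx :=
  ([ffun j : 'I_n => (N * (i == j :> nat))%N], (N * (i == n))%:Z).

Lemma incr_ray i N : incr_at i (ray i N) = ray i N.+1.
Proof.
apply: idx_ext => [j|] /=; first by rewrite !ffunE mulSn addnC.
by rewrite mulSn addnC PoszD.
Qed.

Lemma zero_below_ray i N : zero_below i (ray i N).
Proof. by apply/zero_belowP => j ji; rewrite /= ffunE gtn_eqF ?muln0. Qed.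

Lemma pos_at_ray i N : pos_at i (ray i N.+1).
Proof. by rewrite -incr_ray pos_at_incr. Qed.

Lemma decr_ray i N : decr_at i (ray i N.+1) = ray i N.
Proof. by rewrite -incr_ray incr_atK. Qed.

Lemma ray_eq i M N : (i <= n)%N -> (ray i M == ray i N) = (M == N).
Proof.
move=> i_n; apply/eqP/eqP => [|->] // [/ffunP eq1 eq2].
move: i_n; rewrite leq_eqVlt => /predU1P[i_n|i_n].
  by move: eq2; rewrite i_n eqxx !muln1.
by have := eq1 (Ordinal i_n); rewrite !ffunE /= eqxx !muln1.
Qed.

Lemma pow_ray i p f N : (i <= n)%N ->
  pi (apow (w i) p) f (ray i (p + N)) = f (ray i N).
Proof.
move=> i_n; elim: p f => [|p IH] f.
  by rewrite apow0; have [_ ->] := pi_hom.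
rewrite apowS piM pi_w // shift_opE.
by rewrite addSn zero_below_ray pos_at_ray decr_ray IH.
Qed.

Lemma star_pow_ket i q N : (i <= n)%N ->
  pi (apow (star (w i)) q) (ket R (ray i (q + N))) = ket R (ray i N).
Proof.
move=> i_n; elim: q => [|q IH].
  by rewrite apow0; have [_ ->] := pi_hom.
rewrite apowSr piM pi_star pi_w // star_pop_ket /= /shift_fwd.
by rewrite addSn zero_below_ray pos_at_ray decr_ray.
Qed.

Lemma source_ket i N : (i <= n)%N ->
  pi (tsource w i) (ket R (ray i N)) = ket R (ray i N).
Proof.
move=> i_n; apply: ell2_ext => k; rewrite piM pi_star pi_w //.
have := shift_source_projE i (ket R (ray i N)) k => /= ->.
case: ifP => // zk; apply/esym; case: eqP => // kE.
by rewrite kE zero_below_ray in zk.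
Qed.

Lemma next_source_ket i N : (i <= n)%N ->
  pi (tsource w i.+1) (ket R (ray i N.+1)) = 0.
Proof.
rewrite leq_eqVlt => /predU1P[->|i_n].
  by rewrite /tsource (tower_top w_rel) // amul0r (lin0 lin_pi).
rewrite piM pi_w // pop_ket /= /shift_bwd zero_belowS //.
by rewrite pos_at_ray andbF (lin0 (bop_linear _)).
Qed.

(** Far out on the half-line the words that continue to the next level vanish,
    and the matrix coefficients are those of a Laurent polynomial in the
    bilateral shift. *)
Lemma shift_coeff_le i d c (T : nat -> nat -> A) : (i <= n)%N ->
  laurent_coeff c -> (forall p q, tspan w i.+1 d (T p q)) ->
  forall p q, (p <= d)%N -> (q <= d)%N ->
  `|c p q| <= `|pi (normal_form w i d c T)|.
Proof.
move=> i_n hc hT p q pd qd.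
have [pq|] := boolP ((p != 0%N) && (q != 0%N)); first by rewrite hc ?normr0.
rewrite negb_and !negbK => pq.
(* [d.+1] is beyond every power that occurs in a word of degree [d]. *)
pose entry x : R[i] := pi x (ket R (ray i (d.+1 + q))) (ray i (d.+1 + p)).
have entry_lin : linear (entry : A -> R[i]^o).
  by move=> a x y; rewrite /entry lin_pi.
have entry_le x : `|entry x| <= `|pi x|.
  apply: le_trans (coord_le _ _) _; rewrite bop_normE lecR.
  by apply: le_trans ((bop_bound _).2 _) _; rewrite norm_ket mulr1.
suff <- : entry (normal_form w i d c T) = c p q by exact: entry_le.
have term (a b : nat) : (a <= d)%N -> (b <= d)%N ->
    entry (conjug w i a b (c a b *: tsource w i + T a b)) =
    if (a == p) && (b == q) then c a b else 0.
  move=> ad bd; rewrite /entry /conjug !piM.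
  have -> : (d.+1 + q = b + (d - b + q).+1)%N by lia.
  have -> : (d.+1 + p = a + (d - a + p).+1)%N by lia.
  rewrite star_pow_ket // pow_ray // lin_pi.
  have tail0 : pi (T a b) (ket R (ray i (d - b + q).+1)) = 0.
    rewrite -(tspan_tsource w_rel (hT a b)) piM next_source_ket //.
    exact: lin0 (bop_linear _).
  rewrite [LHS](_ : _ = c a b * pi (tsource w i) (ket R (ray i (d - b + q).+1))
    (ray i (d - a + p).+1) + pi (T a b) (ket R (ray i (d - b + q).+1))
    (ray i (d - a + p).+1)) // tail0 ell2_0E addr0 source_ket //= ray_eq //.
  rewrite eqSS; case: (altP (_ =P _)) => [eq_ab|ne_ab]; last first.
    rewrite mulr0; case: ifP => // /andP[/eqP ap /eqP bq].
    by rewrite ap bq in ne_ab; case/negP: ne_ab; apply/eqP; lia.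
  rewrite mulr1; case: ifP => // ab; apply: hc.
  by case/orP: pq => /eqP pq; rewrite pq in eq_ab ab *; lia.
rewrite -(sum2_delta c pd qd) /normal_form.
move: (entry) entry_lin term => phi phi_lin term.
rewrite (lin_sum phi_lin); apply: eq_bigr => a _.
rewrite (lin_sum phi_lin); apply: eq_bigr => b _.
have ad : (a <= d)%N by rewrite -ltnS.
have bd : (b <= d)%N by rewrite -ltnS.
exact: term.
Qed.

End ShiftCoefficients.

(** * Faithfulness on the envelope *)

Section RangeClosure.
Variables (K : numClosedFieldType) (A : unitalStarAlgType K).
Variables (B : unitalCStarAlgType K) (h : A -> B).
Hypothesis h_hom : unital_star_hom h.

Definition range_closure (x : B) : Prop :=
  forall e : K, 0 < e -> exists a, `|x - h a| < e.

Let lh := let: conj (conj (conj l _) _) _ := h_hom in l.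
Let mh := let: conj (conj (conj _ m) _) _ := h_hom in m.
Let sh := let: conj (conj _ s) _ := h_hom in s.

Lemma range_closure_mem a : range_closure (h a).
Proof. by move=> e e0; exists a; rewrite subrr normr0. Qed.

Fact range_closure1 : range_closure aone.
Proof. by have [_ <-] := h_hom; exact: range_closure_mem. Qed.

Let mul_small (c t e : K) : 0 <= c -> 0 <= t -> t < e / 2 / (c + 1) ->
  0 < e -> c * t < e / 2.
Proof.
move=> c0 t0 te e0; have c1 : 0 < c + 1 by rewrite ltr_wpDl.
apply: (@le_lt_trans _ _ ((c + 1) * t)); last by rewrite mulrC -ltr_pdivlMr.
by apply: ler_pM => //; rewrite lerDl.
Qed.

Fact range_closure_lin (c : K) x y :
  range_closure x -> range_closure y -> range_closure (c *: x + y).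
Proof.
move=> hx hy e e0; have e20 : 0 < e / 2 by rewrite divr_gt0.
have [|a xa] := hx (e / 2 / (`|c| + 1)); first by rewrite divr_gt0 // ltr_wpDl.
have [b yb] := hy _ e20; exists (c *: a + b).
rewrite lh opprD addrACA -scalerBr (le_lt_trans (ler_normD _ _)) //.
by rewrite (splitr e) ltrD // normrZ; apply: mul_small.
Qed.

(** The approximation of [y] is chosen after the one of [x], whose norm enters
    the tolerance. *)
Fact range_closureM x y :
  range_closure x -> range_closure y -> range_closure (x ** y).
Proof.
move=> hx hy e e0; have e20 : 0 < e / 2 by rewrite divr_gt0.
have [|a xa] := hx (e / 2 / (`|y| + 1)); first by rewrite divr_gt0 // ltr_wpDl.
have [|b yb] := hy (e / 2 / (`|h a| + 1)).
  by rewrite divr_gt0 // ltr_wpDl.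
exists (a ** b); rewrite mh.
have -> : x ** y - h a ** h b = (x - h a) ** y + h a ** (y - h b).
  by rewrite amulBl amulBr addrA subrK.
rewrite (le_lt_trans (ler_normD _ _)) // (splitr e) ltrD //.
  by rewrite (le_lt_trans (norm_amul _ _)) // mulrC; apply: mul_small.
by rewrite (le_lt_trans (norm_amul _ _)) //; apply: mul_small.
Qed.

Fact range_closure_star x : range_closure x -> range_closure (star x).
Proof.
move=> hx e /hx[a xa]; exists (star a).
by rewrite sh -starB cstar_norm_star.
Qed.

Fact range_closure_closed : closed [set x | range_closure x].
Proof.
move=> x clx e e0; have e20 : 0 < e / 2 by rewrite divr_gt0.
have [y [/= /(_ _ e20)[a ya]]] := clx _ (nbhsx_ballx x _ e20).
rewrite -ball_normE /= => xy; exists a.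
by rewrite -(subrK y x) -addrA (le_lt_trans (ler_normD _ _)) // (splitr e) ltrD.
Qed.

Definition range_closed_subalg : closed_subalg B :=
  @ClosedSubalg K B (Subalg range_closure1 range_closure_lin range_closureM
    range_closure_star) range_closure_closed.

End RangeClosure.

Section FaithfulExtension.
Variables (R : realType) (A : unitalStarAlgType R[i]).
Variables (C B : unitalCStarAlgType R[i]) (iota : A -> C) (g : A -> B).
Hypothesis C_envelope : cstar_envelope iota.
Hypothesis g_hom : unital_star_hom g.

(** The envelope maps to the closure of the graph of [g] over [iota] in the
    direct sum; by uniqueness the first component is the identity. Hence the
    pairs [(x, rho x)] are limits of pairs [(iota a, g a)], and a norm
    inequality between [iota] and [g] passes to the limit. *)
Lemma envelope_faithful : (forall a, `|iota a| <= `|g a|) ->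
  exists rho : C -> B, [/\ unital_star_hom rho, forall a, rho (iota a) = g a
    & injective rho].
Proof.
move=> iota_le; have [iota_hom univ] := C_envelope.
pose h (a : A) : dsum C B := (iota a, g a).
have h_hom : unital_star_hom h.
  have [[[li mi] si] i1] := iota_hom; have [[[lg mg] sg] g1] := g_hom.
  split; [split; [split|]|].
  - by move=> c x y; congr pair; rewrite ?li ?lg.
  - by move=> x y; congr pair; rewrite ?mi ?mg.
  - by move=> x; congr pair; rewrite ?si ?sg.
  - by congr pair.
pose E := range_closed_subalg h_hom.
have [G [[G_hom G_iota] _]] := univ (closed_subalg_type E) _
  (subalg_corestrict (Q := E) (range_closure_mem h) h_hom).
pose k x : dsum C B := subalg_val (G x).
have k_hom : unital_star_hom k.
  exact: (unital_star_hom_comp G_hom (subalg_val_hom E)).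
have fst_hom : unital_star_hom (fst : dsum C B -> C) by [].
have snd_hom : unital_star_hom (snd : dsum C B -> B) by [].
have k_iota a : k (iota a) = h a by rewrite /k G_iota.
have k1 x : (k x).1 = x.
  apply: (envelope_hom_ext C_envelope (f := (fst : dsum C B -> C) \o k) (g := id)).
  - exact: unital_star_hom_comp k_hom fst_hom.
  - exact: unital_star_hom_id.
  - by move=> a /=; rewrite k_iota.
pose rho x := (k x).2.
have rho_hom : unital_star_hom rho := unital_star_hom_comp k_hom snd_hom.
exists rho; split=> // [a|x y rho_xy]; first by rewrite /rho k_iota.
have norm_le u : `|u| <= `|rho u|.
  have nE (V : unitalCStarAlgType R[i]) (v : V) : `|v| = (complex.Re `|v|)%:C.
    by rewrite RRe_real // normr_real.
  rewrite nE [leRHS]nE lecR; apply/ler_addgt0Pr => e e0.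
  have e20 : 0 < (e / 2)%:C by rewrite ltcR divr_gt0.
  have [a /ltW] := subalg_valP (G u) _ e20.
  rewrite dsum_norm_le -[val (G u)]/(k u) /= k1 => /andP[ua1 ua2].
  rewrite -lecR -nE -[u in leLHS](subrK (iota a)) (splitr e) !realCD.
  apply: le_trans (ler_normD _ _) _; rewrite addrA addrC lerD //.
  apply: le_trans (iota_le a) _; rewrite -nE.
  rewrite -[g a](subKr (rho u)); apply: le_trans (ler_normB _ _) _.
  by rewrite lerD.
have [[[lrho _] _] _] := rho_hom.
apply/eqP; rewrite -subr_eq0 -normr_le0; apply: le_trans (norm_le _) _.
by rewrite (linB lrho) rho_xy subrr normr0.
Qed.

End FaithfulExtension.

Lemma star_representation_of_hom (R : realType) (I : choiceType)
    (D : unitalStarAlgType R[i]) (rho : D -> bop R I) :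
  unital_star_hom rho -> star_representation (fun x => bop_val (rho x)).
Proof.
move=> [[[lrho mrho] srho] rho1]; do 4?split.
- exact: bop_linear.
- by exists (opnorm (rho a)); exact: (bop_bound (rho a)).2.
- by move=> c a b f; rewrite lrho.
- by move=> a b f; rewrite mrho.
- by move=> f; rewrite rho1.
- by move=> a f g; rewrite srho bop_adjP.
Qed.

Theorem theorem3p14 (R : realType) (n : nat)
    (A : unitalStarAlgType R[i]) (z : 'I_n.+1 -> A)
    (A_sphere : sphere_algebra z)
    (alpha : R[i] -> A -> A) (alpha_action : circle_action alpha)
    (alpha_z : forall u, `|u| = 1 -> forall i, alpha u (z i) = u *: z i)
    (C : unitalCStarAlgType R[i]) (iota : A -> C)
    (C_envelope : cstar_envelope iota)
    (L : starAlgType R[i]) (P : vertex (Sigma n) -> L) (S : edge (Sigma n) -> L)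
    (L_leavitt : leavitt_algebra P S)
    (gamma : R[i] -> L -> L) (gamma_action : circle_action gamma)
    (gamma_P : forall u, `|u| = 1 -> forall v, gamma u (P v) = P v)
    (gamma_S : forall u, `|u| = 1 -> forall e, gamma u (S e) = u *: S e)
    (G : cstarAlgType R[i]) (PG : vertex (Sigma n) -> G)
    (SG : edge (Sigma n) -> G) (G_graph : graph_cstar_algebra PG SG)
    (kappa : L -> G) (kappa_hom : star_hom kappa)
    (kappa_P : forall v, kappa (P v) = PG v)
    (kappa_S : forall e, kappa (S e) = SG e) :
  injective iota /\
  (exists (phi : L -> A) (phi_inv : A -> L),
     (star_hom phi /\ cancel phi phi_inv /\ cancel phi_inv phi) /\
     (forall i : 'I_n.+1, phi (P i) = z i ** star (z i)) /\
     (forall (i j : 'I_n.+1) (le_ij : (i <= j)%N),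
        phi (S (Sigma_e le_ij)) = z i ** z j ** star (z j)) /\
     (forall i : 'I_n.+1,
        phi_inv (z i) = \sum_(e : edge (Sigma n) | src e == i) S e) /\
     (forall u, `|u| = 1 -> forall x, phi (gamma u x) = alpha u (phi x)) /\
     (exists phit : G -> C,
        star_hom phit /\ bijective phit /\
        forall x, phit (kappa x) = iota (phi x))) /\
  (exists pi : A -> ell2 R (basis_index n) -> ell2 R (basis_index n),
     star_representation pi /\
     (forall i k, pi (z i) (ket R k) = shift_ket R i k) /\
     exists rho : C -> ell2 R (basis_index n) -> ell2 R (basis_index n),
       star_representation rho /\ (forall a, rho (iota a) = pi a) /\
       injective rho).
Proof.
have [z_rel univA] := A_sphere.
have [g [[g_hom g_z] _]] := univA _ _ (shift_sphere n R).
have coeff_le := shift_coeff_le z_rel g_hom g_z.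
have g_inj := sphere_hom_inj A_sphere g_hom coeff_le.
have [rho [rho_hom rho_iota rho_inj]] := envelope_faithful C_envelope g_hom
  (sphere_norm_le A_sphere g_hom C_envelope.1 coeff_le).
split; first by move=> a b ab; apply: g_inj; rewrite -!rho_iota ab.
split; last first.
  exists (fun a => bop_val (g a)); split; first exact: star_representation_of_hom.
  split; first by move=> i k; rewrite g_z shift_op_ket.
  exists (fun x => bop_val (rho x)); split; first exact: star_representation_of_hom.
  split; first by move=> a; rewrite rho_iota.
  by move=> x y /val_inj /rho_inj.
have [phi [psi iso]] := leavitt_sphere_iso A_sphere L_leavitt.
have [[phi_hom _ _ phiK psiK] [phi_P phi_S psi_z]] := iso.
exists phi, psi; split; first by [].
split; first exact: phi_P.
split; first by move=> i j le_ij; exact: phi_S.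
split; first exact: psi_z.
split; last exact: (graph_envelope_iso L_leavitt iso C_envelope
  G_graph kappa_hom kappa_P kappa_S).
move=> u u1; have [gammaP _ _] := gamma_action; have [alphaP _ _] := alpha_action.
apply: (sphere_iso_equivariant L_leavitt iso u1); auto.
- exact: (gammaP u u1).1.
- exact: (alphaP u u1).1.
Qed.
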